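(* Let $(R,\mathfrak m)$ be an equidimensional local Noetherian ring of characteristic $p>0$ which is a homomorphic image of a Cohen--Macaulay ring, and let $x_1,x_2,\ldots,x_d$ be a system of parameters of $R$. Then for all integers $k_1,k_2,\ldots,k_d\ge 1$ we have $$\lambda\big(R/(x_1^{k_1},x_2^{k_2},\ldots,x_d^{k_d})^{\ast}\big)\ \ge\ k_1k_2\cdots k_d\ \lambda\big(R/(x_1,x_2,\ldots,x_d)^{\ast}\big).$$
   Context: Here $p$ is a prime, $d=\dim R$, and $\lambda(M)$ denotes the length of an $R$-module $M$. A system of parameters means a full system of parameters: $d$ elements of $\mathfrak m$ generating an $\mathfrak m$-primary ideal. $R$ is equidimensional if $\dim R/P=\dim R$ for every minimal prime $P$ of $R$. Let $R^{\circ}$ be the complement in $R$ of the union of the minimal primes of $R$. For an ideal $I$ and $q=p^e$, $I^{[q]}=(i^q: i\in I)$. The tight closure $I^{\ast}$ of $I$ is the ideal of all $x\in R$ for which there exists $c\in R^{\circ}$ with $cx^q\in I^{[q]}$ for all sufficiently large $q=p^e$. *)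

(* Defs.v *)
From HB Require Import structures.
From mathcomp Require Import all_boot all_order all_algebra.
From mathcomp Require Import generic_quotient ring_quotient ring.
From mathcomp Require Import boolp classical_sets constructive_ereal.

Set Implicit Arguments.
Unset Strict Implicit.
Unset Printing Implicit Defensive.

Import Order.TTheory GRing.Theory.

Local Open Scope classical_set_scope.
Local Open Scope ring_scope.
Local Open Scope quotient_scope.

(* Supremum of a set of natural numbers, +oo if the set is unbounded and -oo
   if it is empty. *)
Definition nat_sup (A : set nat) : \bar int :=
  supremum -oo%E [set n%:Z%:E | n in A].

(* An idealr or prime_idealr is proper by definition, so ideals that may be the
   whole ring are taken to be the submodules of R^o. *)
Notation ideal R := (submodClosed R^o).

Section QuotientModule.
Variables (R : pzRingType) (V : lmodType R) (N : submodClosed V).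

Definition submod_pred : {pred V} := fun x => x \in N.

HB.instance Definition _ :=
  GRing.isZmodClosed.Build V submod_pred
    (GRing.submod_closedB (submodClosedP N)).

Definition lmod_quot := {ideal_quot submod_pred}.

HB.instance Definition _ := GRing.Zmodule.on lmod_quot.
HB.instance Definition _ : EqQuotient V (Quotient.equiv submod_pred) lmod_quot :=
  EqQuotient.on lmod_quot.
HB.instance Definition _ := ZmodQuotient.on lmod_quot.

Definition lmod_quot_scale (a : R) := lift_op1 lmod_quot ( *:%R a).

Fact lmod_quot_scale_pi a (v : V) :
  lmod_quot_scale a (\pi_lmod_quot v) = \pi_lmod_quot (a *: v).
Proof.
unlock lmod_quot_scale; apply/eqP; rewrite -Quotient.idealrBE -scalerBr.
have : repr (\pi_lmod_quot v) - v \in submod_pred.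
  by rewrite Quotient.idealrBE reprK.
exact: rpredZ.
Qed.

Fact lmod_quot_scaleA a b x :
  lmod_quot_scale a (lmod_quot_scale b x) = lmod_quot_scale (a * b) x.
Proof. by elim/quotW: x => v; rewrite !lmod_quot_scale_pi scalerA. Qed.

Fact lmod_quot_scale1 : left_id 1 lmod_quot_scale.
Proof. by elim/quotW=> v; rewrite lmod_quot_scale_pi scale1r. Qed.

Fact lmod_quot_scaleDr : right_distributive lmod_quot_scale +%R.
Proof.
move=> a; elim/quotW=> v; elim/quotW=> w; rewrite !lmod_quot_scale_pi.
by rewrite -!pi_addr lmod_quot_scale_pi scalerDr.
Qed.

Fact lmod_quot_scaleDl x : {morph lmod_quot_scale^~ x : a b / a + b}.
Proof.
elim/quotW: x => v a b; rewrite !lmod_quot_scale_pi.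
by rewrite -pi_addr scalerDl.
Qed.

HB.instance Definition _ := GRing.Zmodule_isLmodule.Build R lmod_quot
  lmod_quot_scaleA lmod_quot_scale1 lmod_quot_scaleDr lmod_quot_scaleDl.

End QuotientModule.

Notation "V /% N" := (@lmod_quot _ V N)
  (at level 40, no associativity) : type_scope.

Definition length (R : pzRingType) (M : lmodType R) : \bar int :=
  nat_sup [set n | exists N : nat -> submodClosed M,
    forall i, (i < n)%N -> [set` N i] `<` [set` N i.+1]].

Section Ideals.
Variable R : comNzRingType.

Section Span.
Variable A : set R.

Definition ideal_span : {pred R^o} :=
  fun x => `[< forall J : ideal R, A `<=` [set` J] -> x \in J >].

Fact ideal_span_closed : GRing.subsemimod_closed ideal_span.
Proof.
split; first split.
- by apply/asboolP => J _; apply: rpred0.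
- move=> x y /asboolP xA /asboolP yA; apply/asboolP => J AJ.
  by apply: rpredD; [apply: xA | apply: yA].
- move=> a x /asboolP xA; apply/asboolP => J AJ.
  by apply: rpredZ; apply: xA.
Qed.

HB.instance Definition _ :=
  GRing.isSubmodClosed.Build R R^o ideal_span ideal_span_closed.
End Span.

Fact ideal_mulr (I : ideal R) (a b : R) : b \in I -> a * b \in I.
Proof. exact: (@rpredZ _ _ I a b). Qed.

Definition noetherian :=
  forall I : ideal R, exists s : seq R, [set` I] = [set` ideal_span [set` s]].

Definition maximal (m : idealr R) :=
  forall J : idealr R, [set` m] `<=` [set` J] -> [set` J] = [set` m].

Definition local_ring (m : idealr R) :=
  maximal m /\ forall n : idealr R, maximal n -> [set` n] = [set` m].

Definition minimal_prime (P : prime_idealr R) :=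
  forall Q : prime_idealr R, [set` Q] `<=` [set` P] -> [set` Q] = [set` P].

Definition krull_dim : \bar int :=
  nat_sup [set n | exists P : nat -> prime_idealr R,
    forall i, (i < n)%N -> [set` P i] `<` [set` P i.+1]].

Definition radical (I : {pred R}) : set R :=
  [set x | exists n : nat, x ^+ n \in I].

Definition primary (I : {pred R}) :=
  1 \notin I /\ forall a b, a * b \in I -> a \in I \/ radical I b.

Definition system_of_parameters (m : idealr R) d (x : 'I_d -> R) :=
  [/\ krull_dim = d%:Z%:E, forall i, x i \in m,
      primary (ideal_span (range x)) &
      radical (ideal_span (range x)) = [set` m]].

Definition regular_sequence (s : seq R) :=
  (forall i, (i < size s)%N ->
     forall y : R^o /% ideal_span [set` take i s], s`_i *: y = 0 -> y = 0) /\
  exists y : R^o /% ideal_span [set` s], y != 0.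

(* For a noetherian local ring with maximal ideal m, depth m is the depth of the
   ring; the empty sequence is regular, so the supremum is over a nonempty set. *)
Definition depth (I : idealr R) : \bar int :=
  nat_sup [set n | exists s : seq R,
    [/\ size s = n, {subset s <= I} & regular_sequence s]].

Definition cohen_macaulay_local (m : idealr R) :=
  [/\ noetherian, local_ring m & depth m = krull_dim].

End Ideals.

Definition equidimensional (R : comNzRingType) :=
  forall P : prime_idealr R, minimal_prime P ->
    krull_dim {ideal_quot P} = krull_dim R.

Section Localization.
Variables (R : comNzRingType) (P : prime_idealr R).

Definition loc_frac := {s : R * R | s.2 \notin P}.
HB.instance Definition _ := Choice.on loc_frac.

Implicit Types x y z : loc_frac.
Local Notation num x := (sval x).1.
Local Notation den x := (sval x).2.

Fact denP x : den x \notin P. Proof. by case: x. Qed.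

Fact prime_notinM a b : a \notin P -> b \notin P -> a * b \notin P.
Proof. by move=> aP bP; rewrite prime_idealrM negb_or aP. Qed.

Fact prime_notin1 : 1 \notin P. Proof. by rewrite idealr1. Qed.

Definition mkfrac a s (sP : s \notin P) : loc_frac :=
  exist (fun t : R * R => t.2 \notin P) (a, s) sP.

Definition loc_equiv x y : bool :=
  `[< exists2 u, u \notin P & u * (num x * den y - num y * den x) = 0 >].

Fact loc_equiv_refl : reflexive loc_equiv.
Proof.
by move=> x; apply/asboolP; exists 1; rewrite ?prime_notin1 // subrr mulr0.
Qed.

Fact loc_equiv_sym : symmetric loc_equiv.
Proof.
by move=> x y; apply: asbool_equiv_eq; split=> -[u uP e]; exists u => //;
  rewrite -[LHS]opprK -mulrN opprB e oppr0.
Qed.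

Fact loc_equiv_trans : transitive loc_equiv.
Proof.
move=> y x z /asboolP[u uP e] /asboolP[v vP f]; apply/asboolP.
exists (u * v * den y); first by rewrite !prime_notinM ?denP.
transitivity (v * den z * (u * (num x * den y - num y * den x))
  + u * den x * (v * (num y * den z - num z * den y))); first by ring.
by rewrite e f !mulr0 addr0.
Qed.

Canonical loc_equiv_equiv :=
  EquivRel loc_equiv loc_equiv_refl loc_equiv_sym loc_equiv_trans.

Definition localization := {eq_quot loc_equiv}.
HB.instance Definition _ : EqQuotient _ loc_equiv localization :=
  EqQuotient.on localization.
HB.instance Definition _ := Choice.on localization.

Local Notation pi := (\pi_localization).

Fact loc_eq x y u : u \notin P ->
  u * (num x * den y - num y * den x) = 0 -> pi x = pi y.
Proof. by move=> uP e; apply/eqmodP/asboolP; exists u. Qed.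

Fact loc_eq1 x y : num x * den y = num y * den x -> pi x = pi y.
Proof.
by move=> e; apply: (@loc_eq _ _ 1 prime_notin1); rewrite e subrr mulr0.
Qed.

Fact loc_repr x : exists2 u, u \notin P &
  u * (num (repr (pi x)) * den x - num x * den (repr (pi x))) = 0.
Proof.
have : repr (pi x) = x %[mod localization] by rewrite reprK.
by move/eqmodP/asboolP.
Qed.

Definition fadd x y : loc_frac :=
  mkfrac (num x * den y + num y * den x) (prime_notinM (denP x) (denP y)).
Definition fmul x y : loc_frac :=
  mkfrac (num x * num y) (prime_notinM (denP x) (denP y)).
Definition fopp x : loc_frac := mkfrac (- num x) (denP x).

Definition loc_zero : localization := pi (mkfrac 0 prime_notin1).
Definition loc_one : localization := pi (mkfrac 1 prime_notin1).
Definition loc_add := lift_op2 localization fadd.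
Definition loc_mul := lift_op2 localization fmul.
Definition loc_opp := lift_op1 localization fopp.

Fact pi_fadd x y : loc_add (pi x) (pi y) = pi (fadd x y).
Proof.
unlock loc_add; have [u uP e] := loc_repr x; have [v vP f] := loc_repr y.
apply: (@loc_eq _ _ (u * v)); first exact: prime_notinM.
rewrite /=; move: e f.
set x' := repr (pi x); set y' := repr (pi y) => e f.
transitivity (v * den y * den y' * (u * (num x' * den x - num x * den x'))
  + u * den x * den x' * (v * (num y' * den y - num y * den y'))); first by ring.
by rewrite e f !mulr0 addr0.
Qed.

Fact pi_fmul x y : loc_mul (pi x) (pi y) = pi (fmul x y).
Proof.
unlock loc_mul; have [u uP e] := loc_repr x; have [v vP f] := loc_repr y.
apply: (@loc_eq _ _ (u * v)); first exact: prime_notinM.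
rewrite /=; move: e f.
set x' := repr (pi x); set y' := repr (pi y) => e f.
transitivity (v * num y' * den y * (u * (num x' * den x - num x * den x'))
  + u * num x * den x' * (v * (num y' * den y - num y * den y'))); first by ring.
by rewrite e f !mulr0 addr0.
Qed.

Fact pi_fopp x : loc_opp (pi x) = pi (fopp x).
Proof.
unlock loc_opp; have [u uP e] := loc_repr x; apply: (@loc_eq _ _ u) => //=.
by rewrite !mulNr -opprD mulrN e oppr0.
Qed.

Fact loc_addA : associative loc_add.
Proof.
elim/quotW=> x; elim/quotW=> y; elim/quotW=> z; rewrite !pi_fadd.
by apply: loc_eq1 => /=; ring.
Qed.

Fact loc_addC : commutative loc_add.
Proof.
elim/quotW=> x; elim/quotW=> y; rewrite !pi_fadd.
by apply: loc_eq1 => /=; ring.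
Qed.

Fact loc_add0 : left_id loc_zero loc_add.
Proof.
elim/quotW=> x; rewrite /loc_zero pi_fadd.
by apply: loc_eq1 => /=; ring.
Qed.

Fact loc_addN : left_inverse loc_zero loc_opp loc_add.
Proof.
elim/quotW=> x; rewrite pi_fopp pi_fadd.
by apply: loc_eq1 => /=; ring.
Qed.

HB.instance Definition _ :=
  GRing.isZmodule.Build localization loc_addA loc_addC loc_add0 loc_addN.

Fact loc_mulA : associative loc_mul.
Proof.
elim/quotW=> x; elim/quotW=> y; elim/quotW=> z; rewrite !pi_fmul.
by apply: loc_eq1 => /=; ring.
Qed.

Fact loc_mulC : commutative loc_mul.
Proof.
elim/quotW=> x; elim/quotW=> y; rewrite !pi_fmul.
by apply: loc_eq1 => /=; ring.
Qed.

Fact loc_mul1 : left_id loc_one loc_mul.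
Proof.
elim/quotW=> x; rewrite /loc_one pi_fmul.
by apply: loc_eq1 => /=; ring.
Qed.

Fact loc_mulDl : left_distributive loc_mul loc_add.
Proof.
elim/quotW=> x; elim/quotW=> y; elim/quotW=> z.
rewrite pi_fadd !pi_fmul pi_fadd.
by apply: loc_eq1 => /=; ring.
Qed.

Fact loc_one_neq0 : loc_one != loc_zero.
Proof.
apply/eqP => /eqmodP/asboolP[u uP]; rewrite /= !mulr1 subr0 mulr1 => u0.
by move: uP; rewrite u0 rpred0.
Qed.

HB.instance Definition _ := GRing.Zmodule_isComNzRing.Build localization
  loc_mulA loc_mulC loc_mul1 loc_mulDl loc_one_neq0.

End Localization.

(* A ring is Cohen-Macaulay if it is noetherian and its localizations at the
   maximal ideals are Cohen-Macaulay local rings; quantifying over prime_idealr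
   loses nothing because maximal ideals are prime. *)
Definition cohen_macaulay (S : comNzRingType) :=
  noetherian S /\
  forall P : prime_idealr S, maximal P ->
    exists n : idealr (localization P), cohen_macaulay_local n.

Definition homomorphic_image (S R : comNzRingType) :=
  exists f : {rmorphism S -> R}, forall y, exists x, f x = y.

Section TightClosure.
Variables (R : comNzRingType) (p : nat).

(* The multiplicative set usually written R with a superscript circle. *)
Definition minimal_compl : set R :=
  [set c | forall P : prime_idealr R, minimal_prime P -> c \notin P].

Definition bracket_power (I : {pred R}) (q : nat) : ideal R :=
  ideal_span [set i ^+ q | i in [set` I]].

(* The argument pR does not occur in the body; the ideal structure below needs
   it, for closure under addition. *)
Definition tight_closure (pR : p \in [pchar R]) (I : {pred R}) : {pred R^o} :=
  fun x : R =>
  `[< exists2 c, minimal_compl c & exists e0 : nat, forall e : nat,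
        (e0 <= e)%N -> c * x ^+ (p ^ e) \in bracket_power I (p ^ e) >].

Fact tight_closure_closed pR I :
  GRing.subsemimod_closed (tight_closure pR I).
Proof.
split; first split.
- apply/asboolP; exists 1; first by move=> P _; rewrite idealr1.
  exists 0%N => e _; rewrite expr0n expn_eq0.
  by have /prime_gt0 := pcharf_prime pR; case: p => //= ? _; rewrite mulr0 rpred0.
- move=> x y /asboolP[c cR [e1 xI]] /asboolP[d dR [e2 yI]].
  apply/asboolP; exists (c * d).
    by move=> P minP; rewrite prime_idealrM negb_or cR ?dR.
  exists (maxn e1 e2) => e; rewrite geq_max => /andP[/xI xIe /yI yIe].
  rewrite exprDn_pchar; last first.
    by rewrite pnatX (eq_pnat _ (pcharf_eq pR)) pnat_id ?(pcharf_prime pR).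
  rewrite mulrDr; apply: rpredD.
    rewrite mulrAC mulrC; exact: ideal_mulr.
  rewrite -mulrA; exact: ideal_mulr.
- move=> a x /asboolP[c cR [e1 xI]]; apply/asboolP; exists c => //.
  exists e1 => e /xI xIe.
  rewrite -[a *: x]/(a * x : R) exprMn mulrCA.
  exact: ideal_mulr.
Qed.

HB.instance Definition _ pR I :=
  GRing.isSubmodClosed.Build R R^o (tight_closure pR I)
    (tight_closure_closed pR I).

End TightClosure.

(* Main.v *)
From HB Require Import structures.
Require Import Defs.
From mathcomp Require Import all_boot all_order all_algebra.
From mathcomp Require Import generic_quotient ring_quotient ring.
From mathcomp Require Import boolp classical_sets constructive_ereal.

(** Write [TC y] for the tight closure of the ideal of a system of parameters
    [y]. The inequality is a chain count that rests on colon capturing: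
    if [y'] is obtained from [y] by raising the entry [y_i] to the power [j + 1]
    and [y_i^j u] lies in [TC y'], then [u] lies in [TC y]
    ([tight_closure_colon]). Granting this, let [B] be the tight closure when
    [s = y_i] is raised to the power [k]. For [j < k] multiplication by [s^j]
    carries a chain of ideals above [TC y] into a chain with as many strict
    inclusions between [B + (s^(j+1))] and [B + (s^j)] ([layer_chain]); these [k]
    chains are end to end, so the length of [R/B] is at least [k] times that of
    [R/TC y]. Raising the exponents one parameter at a time gives the theorem.

    Colon capturing needs one element [c0] outside all minimal primes of [R] that
    multiplies the coefficient [r_j] of any relation [sum r_i y_i = 0] into
    [(y_i : i <> j)], uniformly in the system of parameters [y]: such a [c0] can
    be applied to the relations between [q]-th powers which come from the
    definition of tight closure. A relation is a Koszul cycle of degree one, so it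
    is enough that [c0] kills [H_1(y; R)].

    To find [c0], localize the Cohen-Macaulay ring to a local ring [S] which maps
    onto [R] with kernel [I], and divide by a maximal regular sequence contained
    in [I]. Because [R] is equidimensional, this gives an ideal [J0] in [I] such
    that [S/J0] has depth [d = dim R] and the minimal primes of [I] are minimal
    over [J0], hence associated to [J0] ([equidimensional_cover]). Every system of
    parameters of [R] lifts to a regular sequence on [S/J0] ([lift_parameters]),
    whose Koszul homology on [S/J0] vanishes in positive degrees. A descending
    induction on the degree then shows that some element outside the minimal
    primes of [I] kills [H_i(y; S/J)], [i > 0], for each ideal [J] above [J0]
    ([annihilated_all]): filtering [S/J] by quotients [S/P], [P] prime, the
    quotients with [P] not minimal over [I] are killed by such an element, and
    otherwise [S/P] embeds in [S/J0], which shifts the degree up by one. The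
    case [J = I], [i = 1] is what is wanted.

    The dimension theory is elementary. What replaces Krull's height theorem is
    [depth_ge_assoc]: if [Q] is associated to [S/J], an ideal primary to the
    maximal ideal modulo [Q] needs at least depth [S/J] generators.

    Ideals are sets with closure properties, so that sums, colons, images and
    preimages of ideals are ordinary set expressions. *)

Set Implicit Arguments.
Unset Strict Implicit.
Unset Printing Implicit Defensive.

Import Order.TTheory GRing.Theory Num.Theory.

Local Open Scope classical_set_scope.
Local Open Scope ring_scope.
Local Open Scope quotient_scope.

(** * Ideals as sets *)

Section IdealSets.
Variable S : comNzRingType.
Implicit Types (I J K P Q A : set S) (a b r s t x y : S).

Record is_ideal I : Prop := IsIdeal {
  ideal_0 : I 0;
  ideal_D : forall x y, I x -> I y -> I (x + y);
  ideal_M : forall a x, I x -> I (a * x) }.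

Lemma ideal_Mr I a x : is_ideal I -> I x -> I (x * a).
Proof. by move=> iI Ix; rewrite mulrC; apply: ideal_M. Qed.

Lemma ideal_N I x : is_ideal I -> I x -> I (- x).
Proof. by move=> iI Ix; rewrite -mulN1r; apply: ideal_M. Qed.

Lemma ideal_B I x y : is_ideal I -> I x -> I y -> I (x - y).
Proof. by move=> iI Ix Iy; apply: ideal_D => //; apply: ideal_N. Qed.

Lemma ideal_sub I x y : is_ideal I -> I (x - y) -> I y -> I x.
Proof. by move=> iI Ixy Iy; rewrite -(subrK y x); apply: ideal_D. Qed.

Lemma ideal_subr I x y : is_ideal I -> I (x - y) -> I x -> I y.
Proof.
by move=> iI Ixy; apply: ideal_sub => //; rewrite -opprB; apply: ideal_N.
Qed.

Lemma is_ideal0 : is_ideal [set 0].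
Proof.
split=> //= [x y -> ->|a x ->]; first by rewrite addr0.
by rewrite mulr0.
Qed.

Record is_prime P : Prop := IsPrime {
  prime_ideal : is_ideal P;
  prime_1 : ~ P 1;
  prime_M : forall a b, P (a * b) -> P a \/ P b }.

Lemma prime_X P x n : is_prime P -> P (x ^+ n) -> P x.
Proof.
move=> pP; elim: n => [|n IH]; first by rewrite expr0 => /(prime_1 pP).
by rewrite exprS => /(prime_M pP)[].
Qed.

Definition adjoin J s : set S := [set r | exists a, J (r - a * s)].

Lemma adjoin_ideal J s : is_ideal J -> is_ideal (adjoin J s).
Proof.
move=> iJ; split.
- by exists 0; rewrite mul0r subr0; apply: ideal_0.
- move=> x y [a Ja] [b Jb]; exists (a + b).
  by rewrite mulrDl opprD addrACA; apply: ideal_D.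
- move=> a x [b Jb]; exists (a * b).
  by rewrite -mulrA -mulrBr; apply: ideal_M.
Qed.

Lemma sub_adjoin J s : is_ideal J -> J `<=` adjoin J s.
Proof. by move=> iJ x Jx; exists 0; rewrite mul0r subr0. Qed.

Lemma adjoin_self J s : is_ideal J -> adjoin J s s.
Proof. by move=> iJ; exists 1; rewrite mul1r subrr; apply: ideal_0. Qed.

Lemma adjoinS J K s : J `<=` K -> adjoin J s `<=` adjoin K s.
Proof. by move=> JK x [a Ja]; exists a; apply: JK. Qed.

Lemma adjoin_sub J K s : is_ideal K -> J `<=` K -> K s -> adjoin J s `<=` K.
Proof.
by move=> iK JK Ks x [a /JK]; move/(ideal_sub iK); apply; apply: ideal_M.
Qed.

Lemma adjoinC J s t : is_ideal J -> adjoin (adjoin J s) t = adjoin (adjoin J t) s.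
Proof.
move=> iJ; apply/seteqP; split.
  have iK := adjoin_ideal s (adjoin_ideal t iJ).
  apply: adjoin_sub => //; first by apply/adjoinS/sub_adjoin.
  exact/sub_adjoin/adjoin_self/iJ/adjoin_ideal.
have iK := adjoin_ideal t (adjoin_ideal s iJ).
apply: adjoin_sub => //; first by apply/adjoinS/sub_adjoin.
exact/sub_adjoin/adjoin_self/iJ/adjoin_ideal.
Qed.

Definition colon J s : set S := [set r | J (r * s)].

Lemma colon_ideal J s : is_ideal J -> is_ideal (colon J s).
Proof.
move=> iJ; split; rewrite /colon /=.
- by rewrite mul0r; apply: ideal_0.
- by move=> x y Jx Jy; rewrite mulrDl; apply: ideal_D.
- by move=> a x Jx; rewrite -mulrA; apply: ideal_M.
Qed.

Definition regular_mod J a := forall r, J (a * r) -> J r.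

Definition assoc_prime J P := is_prime P /\ exists s, P = colon J s.

Lemma sub_assoc_prime J P : is_ideal J -> assoc_prime J P -> J `<=` P.
Proof. by move=> iJ [_ [s ->]] x Jx; apply: ideal_Mr. Qed.

(** Noetherianity as the maximal condition, the form in which it is used. *)
Definition maximal_condition :=
  forall F : set S -> Prop, (exists J, F J) -> (forall J, F J -> is_ideal J) ->
  exists2 J, F J & forall K, F K -> J `<=` K -> K `<=` J.

Lemma noetherian_ind (mc : maximal_condition) (C : set S -> Prop) :
  (forall J, is_ideal J ->
     (forall K, is_ideal K -> J `<=` K -> ~ K `<=` J -> C K) -> C J) ->
  forall J, is_ideal J -> C J.
Proof.
move=> step J iJ; apply: contrapT => nCJ.
have [||K [iK nCK] maxK] := mc (fun K => is_ideal K /\ ~ C K).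
- by exists J.
- by move=> K [].
apply: nCK; apply: step => // L iL KL nLK; apply: contrapT => nCL.
exact/nLK/maxK.
Qed.

(** * Associated primes and prime avoidance *)

(** Prime ideals arise as the maximal elements among the proper ideals [(J : t)]
    that contain [A]. *)
Lemma assoc_prime_above (mc : maximal_condition) J s A : is_ideal J ->
  ~ J s -> A `<=` colon J s -> exists2 P, assoc_prime J P & A `<=` P.
Proof.
move=> iJ nJs As.
have [||_ [t [nJt At ->]] maxt] := mc (fun K => exists t,
    [/\ ~ J t, A `<=` colon J t & K = colon J t]).
- by exists (colon J s), s.
- by move=> K [t [_ _ ->]]; apply: colon_ideal.
exists (colon J t) => //; split; last by exists t.
split; [exact: colon_ideal|by rewrite /colon /= mul1r|].
move=> a b Jabt; have [Jbt|nJbt] := pselect (J (b * t)); [by right|left].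
have : colon J (b * t) a by rewrite /colon /= mulrA.
apply: maxt.
  by exists (b * t); split=> // x /At Jxt; rewrite /colon /= mulrCA; apply: ideal_M.
by move=> x Jxt; rewrite /colon /= mulrCA; apply: ideal_M.
Qed.

Lemma regular_of_assoc (mc : maximal_condition) J a : is_ideal J ->
  (forall P, assoc_prime J P -> ~ P a) -> regular_mod J a.
Proof.
move=> iJ nPa r Jar; apply: contrapT => nJr.
have [|P /nPa nP aP] := @assoc_prime_above mc J r [set a] iJ nJr.
  by move=> _ ->.
exact/nP/aP.
Qed.

(** If [P = (J : s)] is prime, an associated prime of [J] either is [P], when its
    generator can be moved into [Rs] modulo [J], or is associated to [J + (s)];
    Noetherian induction then gives finiteness. *)
Lemma assoc_primes_finite (mc : maximal_condition) J : is_ideal J ->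
  exists L : seq (set S), forall P, assoc_prime J P -> List.In P L.
Proof.
move: J; apply: (noetherian_ind mc) => J iJ IH.
have [J1|nJ1] := pselect (J 1).
  exists [::] => P [pP [s Ps]]; case: (prime_1 pP).
  by rewrite Ps /colon /= mul1r -[s]mulr1; apply: ideal_M.
have [|P [pP [s Ps]] _] := @assoc_prime_above mc J 1 set0 iJ nJ1; first by [].
have nJs : ~ J s by move: (prime_1 pP); rewrite Ps /colon /= mul1r.
have [||L LP] := IH _ (adjoin_ideal s iJ); first exact: sub_adjoin.
  by move=> /(_ s (adjoin_self s iJ)).
exists (P :: L) => Q [pQ [t Qt]].
have [[u [Jut nJu]]|nu] := pselect (exists v, adjoin J s (v * t) /\ ~ J (v * t)).
  left; case: Jut => w Jvw.
  have nQu : ~ Q u by rewrite Qt.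
  have nPw : ~ P w by rewrite Ps => /(ideal_sub iJ Jvw).
  apply/seteqP; split=> x.
    rewrite Ps => Jxs; have : Q (x * u).
      rewrite Qt /colon /= -mulrA; apply: (ideal_sub iJ (y := x * (w * s))).
        by rewrite -mulrBr; apply: ideal_M.
      by rewrite mulrCA; apply: ideal_M.
    by case/(prime_M pQ).
  rewrite Qt => Jxt; have : P (x * w).
    rewrite Ps /colon /= -mulrA; apply: (ideal_subr iJ (x := x * (u * t))).
      by rewrite -mulrBr; apply: ideal_M.
    by rewrite mulrCA; apply: ideal_M.
  by case/(prime_M pP).
right; apply: LP; split=> //; exists t; apply/seteqP; split=> x.
  by rewrite Qt => Jxt; apply: sub_adjoin.
by move=> Jxt; rewrite Qt; apply: contrapT => nJxt; apply: nu; exists x.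
Qed.

Lemma outside_not_contained P (L : seq (set S)) : is_prime P ->
  exists2 y, ~ P y & forall Q, List.In Q L -> is_prime Q -> ~ Q `<=` P -> Q y.
Proof.
move=> pP; elim: L => [|Q L [y nPy Ly]]; first by exists 1 => //; exact: prime_1.
have [[pQ nQP]|nQ] := pselect (is_prime Q /\ ~ Q `<=` P); last first.
  by exists y => // K [<- pQ nQP|/Ly//]; case: nQ.
have [z [Qz nPz]] : exists z, Q z /\ ~ P z.
  apply: contrapT => nz; apply: nQP => z Qz; apply: contrapT => nPz.
  by apply: nz; exists z.
exists (z * y); first by move/(prime_M pP) => [].
move=> K [<- _ _|KL pK nKP]; first exact: ideal_Mr (prime_ideal pQ) _.
by apply: ideal_M; [exact: prime_ideal|exact: Ly].
Qed.

(** Prime avoidance in a coset: the inductive step corrects [x + r], when it falls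
    into the new prime [P], by an element of [A] which lies in all the earlier
    primes except those inside [P]. *)
Lemma coset_prime_avoidance A x (L : seq (set S)) : is_ideal A ->
  exists2 r, A r & forall Q, List.In Q L -> is_prime Q ->
    ~ (Q x /\ A `<=` Q) -> ~ Q (x + r).
Proof.
move=> iA; elim: L => [|P L [r Ar Lr]]; first by exists 0; [exact: ideal_0|].
have [[pP nP Pxr]|nP] := pselect [/\ is_prime P, ~ (P x /\ A `<=` P) & P (x + r)];
  last first.
  exists r => // Q [<- pQ nQ Qx|QL pQ nQ]; first by apply: nP.
  exact: Lr.
have [i Ai nPi] : exists2 i, A i & ~ P i.
  apply: contrapT => ni; apply: nP.
  have AP : A `<=` P.
    by move=> z Az; apply: contrapT => nPz; apply: ni; exists z.
  split=> //; apply: (ideal_sub (prime_ideal pP) (y := - r)); first by rewrite opprK.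
  exact/(ideal_N (prime_ideal pP))/AP.
have [y nPy Ly] := outside_not_contained L pP.
have nPxr : ~ P (x + (r + i * y)).
  rewrite addrA => Pxi; have : P (i * y).
    by apply: (ideal_subr (prime_ideal pP) _ Pxi); rewrite addrK.
  by case/(prime_M pP).
exists (r + i * y); first by apply: ideal_D => //; apply: ideal_Mr.
move=> Q [<- //|QL pQ nQ].
have [QP|nQP] := pselect (Q `<=` P); first by move/QP.
rewrite addrA => Qx; apply: (Lr Q) => //.
apply: (ideal_subr (prime_ideal pQ) _ Qx); rewrite [_ + i * y]addrC addrK.
by apply: ideal_M; [exact: prime_ideal|exact: Ly].
Qed.

End IdealSets.

(** * Depth in a noetherian local ring *)

Section LocalDepth.
Variables (S : comNzRingType) (n : set S).
Implicit Types (I J K P Q A : set S) (a b r s t x y : S).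

Record is_local : Prop := IsLocal {
  local_ideal : is_ideal n;
  local_1 : ~ n 1;
  local_unit : forall u, ~ n u -> exists v, u * v = 1 }.

Hypotheses (mc : maximal_condition S) (loc : is_local).
Let nI : is_ideal n := local_ideal loc.

Lemma proper_sub_local J : is_ideal J -> ~ J 1 -> J `<=` n.
Proof.
move=> iJ nJ1 x Jx; apply: contrapT => /(local_unit loc)[v xv].
by apply: nJ1; rewrite -xv; apply: ideal_Mr.
Qed.

Lemma one_sub_local v a : n a -> exists w, (1 - v * a) * w = 1.
Proof.
move=> na; apply: local_unit => // n1.
apply: (local_1 loc); apply: (ideal_sub nI n1); exact: ideal_M.
Qed.

(** This stands in for Nakayama's lemma and Krull's intersection theorem. Take
    [t] with [J + (t)] maximal; if [t = a t'] then [t'] lies in [J + (t)] too,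
    and [1 - v a] is a unit. *)
Lemma divisible_forever J K a : is_ideal J -> n a ->
  (forall t, K t -> exists2 t', K t' & J (t - a * t')) -> K `<=` J.
Proof.
move=> iJ na div t0 Kt0; apply: contrapT => nJt0.
have [||_ [t [Kt nJt ->]] maxt] := @mc (fun I => exists t,
    [/\ K t, ~ J t & I = adjoin J t]).
- by exists (adjoin J t0), t0.
- by move=> I [t [_ _ ->]]; apply: adjoin_ideal.
have [t' Kt' Jtt'] := div t Kt.
have nJt' : ~ J t'.
  by move=> Jt'; apply: nJt; apply: (ideal_sub iJ Jtt'); apply: ideal_M.
have [||v Jv] := maxt (adjoin J t') _ _ t' (adjoin_self t' iJ).
- by exists t'.
- by apply: adjoin_sub; [exact: adjoin_ideal|exact: sub_adjoin|exists a].
have [w wE] := one_sub_local v na; apply: nJt'.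
rewrite -[t']mulr1 -wE mulrA; apply: ideal_Mr => //.
have -> : t' * (1 - v * a) = (t' - v * t) + v * (t - a * t') by ring.
by apply: ideal_D => //; apply: ideal_M.
Qed.

(** Depth of [S/J] at least [e], by exhibiting a regular sequence in [n]. *)
Fixpoint depth_ge J e : Prop :=
  if e is e'.+1 then exists a, [/\ n a, regular_mod J a & depth_ge (adjoin J a) e']
  else True.

Lemma regular_swap J a b : is_ideal J ->
  regular_mod J a -> regular_mod (adjoin J a) b -> regular_mod (adjoin J b) a.
Proof.
move=> iJ ra rb r [s Jars].
have [|t Jst] := rb s.
  by exists r; rewrite -opprB; apply: ideal_N => //; rewrite mulrC [s * b]mulrC in Jars *.
exists t; apply: ra; rewrite mulrBr.
have -> : a * r - a * (t * b) = (a * r - s * b) + b * (s - t * a) by ring.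
by apply: ideal_D => //; apply: ideal_M.
Qed.

(** The socle of [S/(J + a)] does not depend on the regular element [a]: if [s]
    spans a socle line modulo [J + (b)], then [a s = b t] and [t] spans one
    modulo [J + (a)]. *)
Lemma socle_exchange J a b s : is_ideal J -> n a -> n b ->
  regular_mod J a -> regular_mod J b ->
  ~ adjoin J b s -> n `<=` colon (adjoin J b) s ->
  exists2 t, ~ adjoin J a t & n `<=` colon (adjoin J a) t.
Proof.
move=> iJ na nb ra rb ns nsc; have [t Jast] := nsc a na.
exists t.
  move=> [v Jtv]; apply: ns; exists v; apply: ra.
  have -> : a * (s - v * b) = (a * s - t * b) + b * (t - v * a) by ring.
  by apply: ideal_D => //; apply: ideal_M.
move=> r nr; have [u Jrsu] := nsc r nr; exists u; apply: rb.
have -> : b * (r * t - u * a) = a * (r * s - u * b) - r * (a * s - t * b) by ring.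
by apply: ideal_B => //; apply: ideal_M.
Qed.

(** Two ideals at once, because the induction for [depth_ge_adjoin] needs an
    element that is regular modulo both. *)
Lemma regular_in_coset2 J1 J2 A x : is_ideal J1 -> is_ideal J2 -> is_ideal A ->
  (forall P, assoc_prime J1 P -> ~ (P x /\ A `<=` P)) ->
  (forall P, assoc_prime J2 P -> ~ (P x /\ A `<=` P)) ->
  exists r, [/\ A r, regular_mod J1 (x + r) & regular_mod J2 (x + r)].
Proof.
move=> i1 i2 iA h1 h2.
have [L1 L1P] := assoc_primes_finite mc i1.
have [L2 L2P] := assoc_primes_finite mc i2.
have [r Ar rP] := coset_prime_avoidance x (L1 ++ L2) iA.
exists r; split=> //; apply: regular_of_assoc => // P aP;
  apply: rP; (try exact: (proj1 aP)); (try exact: h1); (try exact: h2);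
  apply: List.in_or_app; [left|right]; auto.
Qed.

Lemma regular_in_coset J A x : is_ideal J -> is_ideal A ->
  (forall P, assoc_prime J P -> ~ (P x /\ A `<=` P)) ->
  exists2 r, A r & regular_mod J (x + r).
Proof.
by move=> iJ iA h; have [r [Ar rr _]] := regular_in_coset2 iJ iJ iA h h; exists r.
Qed.

Lemma local_not_assoc J a P : is_ideal J -> n a -> regular_mod J a ->
  assoc_prime J P -> ~ n `<=` P.
Proof.
move=> iJ na ra [pP [s Ps]] nP; apply: (prime_1 pP); rewrite Ps /colon /= mul1r.
by apply: ra; have := nP a na; rewrite Ps.
Qed.

(** The element [a] starting the given regular sequence and the element [b] are
    compared through a third one, [c], regular modulo [J + (a)] and [J + (b)].
    It exists by prime avoidance: [n] is not associated to [J + (a)], and then by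
    [socle_exchange] not to [J + (b)] either. *)
Lemma depth_ge_adjoin J b e : is_ideal J -> n b ->
  regular_mod J b -> depth_ge J e.+1 -> depth_ge (adjoin J b) e.
Proof.
elim: e J b => // e IH J b iJ nb rb [a [na ra [a' [na' ra' da']]]].
have iJa := adjoin_ideal a iJ; have iJb := adjoin_ideal b iJ.
have nassA P : assoc_prime (adjoin J a) P -> ~ (P 0 /\ n `<=` P).
  by move=> aP [_]; apply: (local_not_assoc iJa na' ra' aP).
have nassB P : assoc_prime (adjoin J b) P -> ~ (P 0 /\ n `<=` P).
  move=> [pP [s Ps]] [_ nP].
  have [||t nt nct] := socle_exchange iJ na nb ra rb (s := s).
  - by move=> Js; apply: (prime_1 pP); rewrite Ps /colon /= mul1r.
  - by rewrite -Ps.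
  by apply: nt; apply: ra'; apply: nct.
have [c [nc]] := regular_in_coset2 iJa iJb nI nassA nassB.
rewrite add0r => rca rcb.
have iJc := adjoin_ideal c iJ.
exists c; split=> //.
rewrite adjoinC //; apply: (IH (adjoin J c)) => //.
  exact: regular_swap rb rcb.
exists a; split=> //; first exact: regular_swap rca.
by rewrite adjoinC //; apply: (IH (adjoin J a)) => //; exists a'.
Qed.

(** The radical of [A + (y 0, ..., y (t-1))] contains [n]. In terms of primes the
    condition passes to larger [A] without computation. *)
Definition primary_mod A (y : nat -> S) (t : nat) := forall P, is_prime P ->
  A `<=` P -> (forall i, (i < t)%N -> P (y i)) -> n `<=` P.

(** The substitute for Krull's height theorem. In the induction on [t], either
    the last [y] lies in a larger associated prime [Q'], where it is superfluous,
    or some [y + q], [q] in [Q], is regular modulo [J]. In the second case the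
    elements killed by [Q] modulo [J] are not all in [J + (y + q)], since they
    would then be divisible by [y + q] forever; so some prime associated to
    [J + (y + q)] contains [Q] and [y]. *)
Lemma depth_ge_assoc J Q (y : nat -> S) (t e : nat) : is_ideal J -> depth_ge J e ->
  assoc_prime J Q -> (forall i, (i < t)%N -> n (y i)) -> primary_mod Q y t ->
  (e <= t)%N.
Proof.
elim: t J Q e => [|t IH] J Q [|e] // iJ dJ aQ ny prim.
  case: dJ => a [na ra _]; case: (local_not_assoc iJ na ra aQ).
  by apply: prim => //; case: aQ.
have [[Q' [aQ' QQ' Qy]]|nQ'] :=
    pselect (exists Q', [/\ assoc_prime J Q', Q `<=` Q' & Q' (y t)]).
  apply: leqW; apply: (IH J Q') => //; first by move=> i it; apply/ny/ltnW.
  move=> P pP Q'P Py; apply: prim => //; first exact: subset_trans Q'P.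
  by move=> i; rewrite ltnS leq_eqVlt => /predU1P[->|/Py//]; apply: Q'P.
have [pQ [s Qs]] := aQ.
have iQ := prime_ideal pQ.
have [P aP [Py QP]|q Qq rq] := @regular_in_coset J Q (y t) iJ iQ.
  by apply: nQ'; exists P.
set b := y t + q in rq.
have nb : n b.
  apply: ideal_D => //; first exact: ny.
  by apply: (proper_sub_local iQ) => //; exact: prime_1.
have [s' Qs' ns'] : exists2 s', (forall x, Q x -> J (x * s')) & ~ adjoin J b s'.
  apply: contrapT => ns'; apply: (prime_1 pQ); rewrite Qs /colon /= mul1r.
  apply: (@divisible_forever J (fun t => forall x, Q x -> J (x * t)) b) => //.
    move=> u Qu; have [] := pselect (adjoin J b u) => [[v Juv]|nu]; last first.
      by case: ns'; exists u.
    exists v; last by rewrite mulrC.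
    move=> x Qx; apply: rq; apply: (ideal_subr iJ _ (Qu x Qx)).
    have -> : x * u - b * (x * v) = x * (u - v * b) by ring.
    exact: ideal_M.
  by move=> x; rewrite Qs.
have iJb := adjoin_ideal b iJ.
have [|Q' aQ' Q'b] :=
    @assoc_prime_above S mc (adjoin J b) s' (adjoin Q b) iJb ns'.
  apply: adjoin_sub; first exact: colon_ideal.
    by move=> x /Qs' Jx; apply: sub_adjoin.
  by rewrite /colon /= mulrC; apply: ideal_M => //; exact: adjoin_self.
apply: (IH (adjoin J b) Q' e) => //.
- exact: depth_ge_adjoin.
- by move=> i it; apply/ny/ltnW.
move=> P pP Q'P Py; have QP : Q `<=` P.
  by apply: subset_trans Q'P; apply: subset_trans Q'b; apply: sub_adjoin.
apply: prim => // i; rewrite ltnS leq_eqVlt => /predU1P[->|/Py//].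
apply: (ideal_sub (prime_ideal pP) (y := b)).
  by rewrite /b opprD addrA subrr sub0r; apply: ideal_N; [exact: prime_ideal|exact: QP].
exact/Q'P/Q'b/adjoin_self.
Qed.

End LocalDepth.

(** * Heights, and a Cohen-Macaulay cover of the same dimension *)

Section Heights.
Variable S : comNzRingType.
Implicit Types (I J K P Q A : set S) (a b r s t x y z : S).
Hypothesis mc : maximal_condition S.

Definition minimal_over I P := [/\ is_prime P, I `<=` P &
  forall Q, is_prime Q -> I `<=` Q -> Q `<=` P -> P `<=` Q].

Fixpoint height_ge Q h : Prop :=
  if h is h'.+1 then exists P, [/\ is_prime P, P `<=` Q, ~ Q `<=` P & height_ge P h']
  else True.

Fixpoint coheight_ge Q h : Prop :=
  if h is h'.+1 then exists P, [/\ is_prime P, Q `<=` P, ~ P `<=` Q & coheight_ge P h']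
  else True.

(** The contraction to [S] of the extension of [J] to the localization at [Q]. *)
Definition local_part J Q : set S := [set r | exists2 t, ~ Q t & J (t * r)].

Lemma local_part_ideal J Q : is_ideal J -> is_prime Q -> is_ideal (local_part J Q).
Proof.
move=> iJ pQ; split.
- by exists 1; [exact: prime_1|rewrite mulr0; apply: ideal_0].
- move=> x y [t nQt Jtx] [u nQu Juy]; exists (t * u); first by move/(prime_M pQ)=> [].
  have -> : t * u * (x + y) = u * (t * x) + t * (u * y) by ring.
  by apply: ideal_D => //; apply: ideal_M.
- by move=> a x [t nQt Jtx]; exists t => //; rewrite mulrCA; apply: ideal_M.
Qed.

Lemma sub_local_part J Q : is_prime Q -> J `<=` local_part J Q.
Proof. by move=> pQ x Jx; exists 1; [exact: prime_1|rewrite mul1r]. Qed.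

(** An element [q] of [P] outside [Q] would be invertible after localization, and
    [q s = 0] there would force [s = 0]. *)
Lemma local_part_assoc J Q : is_ideal J -> is_prime Q -> J `<=` Q ->
  exists P s, [/\ is_prime P, P = colon (local_part J Q) s,
                  ~ local_part J Q s, J `<=` P & P `<=` Q].
Proof.
move=> iJ pQ JQ; have iK := local_part_ideal iJ pQ.
have nK1 : ~ local_part J Q 1.
  by move=> [t nQt]; rewrite mulr1 => /JQ.
have [|P aP _] := @assoc_prime_above S mc _ 1 set0 iK nK1; first by [].
have KP := sub_assoc_prime iK aP; have [pP [s Ps]] := aP.
have nKs : ~ local_part J Q s.
  by move=> Ks; apply: (prime_1 pP); rewrite Ps /colon /= mul1r.
exists P, s; split=> //; first by apply: subset_trans KP; exact: sub_local_part.
move=> q; rewrite Ps => -[t nQt Jtqs]; apply: contrapT => nQq; apply: nKs.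
by exists (t * q); [move/(prime_M pQ) => []|rewrite -mulrA].
Qed.

(** A regular element stays regular in the localization at [Q], so it avoids the
    associated primes found there. Each regular element of [Q] thus adds one to
    the height of [Q]. *)
Lemma prime_avoiding_regular J Q : is_ideal J -> is_prime Q -> J `<=` Q ->
  exists P, [/\ is_prime P, J `<=` P, P `<=` Q & forall z, regular_mod J z -> ~ P z].
Proof.
move=> iJ pQ JQ; have [P [s [pP Ps nKs JP PQ]]] := local_part_assoc iJ pQ JQ.
exists P; split=> // z rz; rewrite Ps => -[t nQt Jtzs]; apply: nKs.
by exists t => //; apply: rz; rewrite mulrCA.
Qed.

(** An associated prime of the localization at [P] lies inside [P], hence equals
    it. Taking [(J : t s)] maximal clears all denominators at once. *)
Lemma minimal_over_assoc J P : is_ideal J -> minimal_over J P -> assoc_prime J P.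
Proof.
move=> iJ [pP JP minP].
have [Q [s [pQ Qs nKs JQ QP]]] := local_part_assoc iJ pP JP.
have PQ := minP Q pQ JQ QP.
have [||_ [t [nPt ->]] maxt] := @mc (fun I => exists t,
    ~ P t /\ I = colon J (t * s)).
- by exists (colon J (1 * s)), 1; split=> //; exact: prime_1.
- by move=> I [t [_ ->]]; apply: colon_ideal.
split=> //; exists (t * s); apply/seteqP; split=> r.
  move=> /PQ; rewrite Qs => -[u nPu Jurs].
  apply: (maxt (colon J (u * t * s))).
  - by exists (u * t); split=> // /(prime_M pP)[].
  - by move=> x; rewrite /colon /= -mulrA [x * (u * _)]mulrCA; apply: ideal_M.
  rewrite /colon /=; have -> : r * (u * t * s) = t * (u * (r * s)) by ring.
  exact: ideal_M.
rewrite /colon /= => Jrts; apply: QP; rewrite Qs; exists t => //.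
by rewrite mulrCA.
Qed.

Inductive regular_ext I : nat -> set S -> Prop :=
| regular_ext0 : regular_ext I 0 [set 0]
| regular_extS h J z : regular_ext I h J -> I z -> regular_mod J z ->
    regular_ext I h.+1 (adjoin J z).

Lemma regular_ext_ideal I h J : regular_ext I h J -> is_ideal J.
Proof. by elim=> [|*]; [exact: is_ideal0|exact: adjoin_ideal]. Qed.

Lemma regular_ext_sub I h J : is_ideal I -> regular_ext I h J -> J `<=` I.
Proof.
move=> iI; elim=> [_ ->|*]; first exact: ideal_0.
exact: adjoin_sub.
Qed.

Lemma regular_ext_height I h J Q : regular_ext I h J -> is_prime Q ->
  J `<=` Q -> height_ge Q h.
Proof.
move=> rJ; elim: rJ Q => // {}h {}J z rJ IH Iz rz Q pQ JzQ.
have iJ := regular_ext_ideal rJ.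
have [|P [pP JP PQ nP]] := prime_avoiding_regular iJ pQ.
  by apply: subset_trans JzQ; apply: sub_adjoin.
exists P; split=> //; last exact: IH.
by move=> QP; apply: (nP z rz); apply/QP/JzQ/adjoin_self.
Qed.

Lemma regular_ext_maximal I : exists h J,
  regular_ext I h J /\ forall z, I z -> regular_mod J z -> J z.
Proof.
have [||J [h rJ] maxJ] := @mc (fun J => exists h, regular_ext I h J).
- by exists [set 0], 0%N; exact: regular_ext0.
- by move=> J [h /regular_ext_ideal].
have iJ := regular_ext_ideal rJ.
exists h, J; split=> // z Iz rz; apply: (maxJ (adjoin J z)).
- by exists h.+1; apply: regular_extS.
- exact: sub_adjoin.
exact: adjoin_self.
Qed.

End Heights.

Section Cover.
Variables (S : comNzRingType) (n : set S).
Implicit Types (I J K P Q A : set S).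
Hypotheses (mc : maximal_condition S) (loc : is_local n).

Lemma regular_ext_dep I h J N : I `<=` n -> depth_ge n [set 0] N ->
  regular_ext I h J -> depth_ge n J (N - h).
Proof.
move=> In dN; elim=> [|{}h {}J z rJ IH Iz rz]; first by rewrite subn0.
have iJ := regular_ext_ideal rJ.
case E: (N - h)%N IH => [|e] IH; first by rewrite subnS E.
by rewrite subnS E /=; apply: depth_ge_adjoin => //; exact: In.
Qed.

(** The ideal [J] is generated by a maximal regular sequence in [I], of length
    [h]. By maximality [I] lies in a prime associated to [J], so [N - h <= d];
    a chain of [d + 1] primes over [I] can be extended below by [h] primes, so
    [h + d <= N]. Hence [h = N - d] and [S/J] has depth [d]. A prime over [J]
    strictly below a minimal prime of [I] would again give a chain that is too
    long. *)
Lemma equidimensional_cover I N d (y : nat -> S) : is_ideal I -> I `<=` n ->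
  depth_ge n [set 0] N ->
  (forall Q a b, is_prime Q -> height_ge Q a -> coheight_ge Q b -> (a + b <= N)%N) ->
  (forall i, (i < d)%N -> n (y i)) -> primary_mod n I y d ->
  (exists Q, [/\ is_prime Q, I `<=` Q & coheight_ge Q d]) ->
  (forall P, minimal_over I P -> coheight_ge P d) ->
  exists J, [/\ is_ideal J, J `<=` I, depth_ge n J d &
    forall P, minimal_over I P -> minimal_over J P].
Proof.
move=> iI In dN dimN ny prim [Q0 [pQ0 IQ0 cQ0]] equi.
have [h [J [rJ maxJ]]] := regular_ext_maximal mc I.
have iJ := regular_ext_ideal rJ; have JI := regular_ext_sub iI rJ.
have [P aP IP] : exists2 P, assoc_prime J P & I `<=` P.
  apply: contrapT => nP.
  have [|||r Ir] := @regular_in_coset S mc J I 0.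
  - exact: iJ.
  - exact: iI.
  - by move=> P aP [_ IP]; apply: nP; exists P.
  rewrite add0r => rr; have Jr := maxJ _ Ir rr.
  have J1 : J 1 by apply: rr; rewrite mulr1.
  exact/(local_1 loc)/In/JI.
have dJ := regular_ext_dep In dN rJ.
have le1 : (N - h <= d)%N.
  apply: (depth_ge_assoc mc loc iJ dJ aP ny) => K pK PK.
  by apply: prim => //; exact: subset_trans PK.
have le2 : (h + d <= N)%N.
  apply: (dimN Q0) => //; apply: (regular_ext_height mc rJ) => //.
  exact: subset_trans IQ0.
have dE : (N - h)%N = d.
  by apply/eqP; rewrite eqn_leq le1 /= leq_subRL ?(leq_trans (leq_addr _ _) le2).
exists J; split=> //; first by rewrite -dE.
move=> P' minP'; have [pP' IP' _] := minP'.
split=> //; first exact: subset_trans IP'.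
move=> Q pQ JQ QP'; apply: contrapT => nP'Q.
have : (h.+1 + d <= N)%N.
  apply: (dimN P') => //; last exact: equi.
  by exists Q; split=> //; apply: (regular_ext_height mc rJ).
by rewrite -dE addSn subnKC ?ltnn // (leq_trans (leq_addr _ _) le2).
Qed.

(** The parameters are changed by elements of [I] one after the other: no prime
    associated to the ideal generated so far contains both [I] and the next
    parameter, because by [depth_ge_assoc] the remaining ones are too few. *)
Lemma lift_parameters I J d (x : nat -> S) : is_ideal I -> I `<=` n ->
  is_ideal J -> J `<=` I -> depth_ge n J d ->
  (forall i, (i < d)%N -> n (x i)) -> primary_mod n I x d ->
  exists2 y : nat -> S, (forall i, I (y i - x i)) &
    forall t, (t < d)%N -> regular_mod (iteri t (fun i K => adjoin K (y i)) J) (y t).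
Proof.
move=> iI In iJ JI dJ nx prim.
pose E (y : nat -> S) t := iteri t (fun i K => adjoin K (y i)) J.
have iE y t : is_ideal (E y t).
  by elim: t => // t IH; exact: adjoin_ideal.
have E_y y t i : (i < t)%N -> E y t (y i).
  elim: t => // t IH; rewrite ltnS leq_eqVlt => /predU1P[->|/IH Eyi].
    exact: (adjoin_self _ (iE y t)).
  exact: (sub_adjoin _ (iE y t)).
have E_eq y z t : (forall i, (i < t)%N -> y i = z i) -> E y t = E z t.
  elim: t => // t IH yz; rewrite /E !iteriS -/(E y t) -/(E z t) yz // IH // => i it.
  exact/yz/ltnW.
suff H t : (t <= d)%N -> exists y : nat -> S, [/\ forall i, I (y i - x i),
    forall i, (i < t)%N -> regular_mod (E y i) (y i) & depth_ge n (E y t) (d - t)].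
  by have [y [Iy ry _]] := H d (leqnn d); exists y.
elim: t => [_|t IH td].
  by exists x; split=> // [i|]; rewrite ?subn0 // subrr; exact: ideal_0.
have [y [Iy ry dy]] := IH (ltnW td).
have [|||r Ir rr] := @regular_in_coset S mc (E y t) I (x t).
- exact: iE.
- exact: iI.
- move=> P aP [Px IP]; have [pP _] := aP.
  have iP := prime_ideal pP.
  suff : (d - t <= d - t.+1)%N by rewrite leqNgt ltn_sub2l.
  apply: (@depth_ge_assoc S n mc loc (E y t) P (fun i => x (t.+1 + i)%N)) => //.
    by move=> i it; apply: nx; rewrite -ltn_subRL.
  move=> Q pQ PQ Qx; apply: prim => //; first exact: subset_trans PQ.
  move=> i id; have [it|ti|->] := ltngtP i t.
  - apply: PQ; apply: (ideal_subr iP (x := y i)); first exact/IP.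
    by apply: (sub_assoc_prime (iE y t) aP); exact: E_y.
  - rewrite -(subnKC ti); apply: Qx; rewrite ltn_sub2r //.
    exact: leq_trans id.
  - exact: PQ.
pose z i := if i == t then x t + r else y i.
have zy i : (i < t)%N -> z i = y i by rewrite /z; case: ltngtP.
have zt : z t = x t + r by rewrite /z eqxx.
exists z; split.
- move=> i; rewrite /z; case: eqP => // ->.
  by rewrite [_ + r]addrC addrK.
- move=> i; rewrite ltnS leq_eqVlt => /predU1P[->|it].
    by rewrite zt (E_eq z y).
  rewrite zy // (E_eq z y); first exact: ry.
  by move=> j ji; apply: zy; exact: ltn_trans it.
- rewrite /E iteriS -/(E z t) zt (E_eq z y) //.
  apply: depth_ge_adjoin => //.
    apply: ideal_D; [exact: local_ideal|exact: nx|exact: In].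
  by rewrite -subSn // subSS.
Qed.

End Cover.

(** * The Koszul complex *)

Section Koszul.
Variable S : comNzRingType.
Implicit Types (I J K P Q A : set S) (r s t x : S) (y : nat -> S) (i n : nat).

(** The total module of the Koszul complex on [n] elements, as an iterated mapping
    cone; the degree is a predicate, so that all degrees share one type. *)
Fixpoint koszul n : lmodType S :=
  if n is n'.+1 then ((koszul n' * koszul n')%type : lmodType S) else S^o.

Fixpoint koszul_d y n : koszul n -> koszul n :=
  match n with
  | 0 => fun=> 0
  | n'.+1 => fun v => (koszul_d y v.1 + y n' *: v.2, - koszul_d y v.2)
  end.

Fixpoint koszul_deg i n : koszul n -> Prop :=
  match n with
  | 0 => fun v => i = 0%N \/ v = 0
  | n'.+1 => fun v => koszul_deg i v.1 /\
      (if i is i'.+1 then koszul_deg i' v.2 else v.2 = 0)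
  end.

Fixpoint koszul_in J n : koszul n -> Prop :=
  match n with
  | 0 => J
  | n'.+1 => fun v => koszul_in J v.1 /\ koszul_in J v.2
  end.

Lemma koszul_dD y n (u v : koszul n) :
  koszul_d y (u + v) = koszul_d y u + koszul_d y v.
Proof.
elim: n u v => [|n IH] /= u v; first by rewrite addr0.
by congr pair => /=; rewrite IH ?opprD // scalerDr addrACA.
Qed.

Lemma koszul_dZ y n s (u : koszul n) : koszul_d y (s *: u) = s *: koszul_d y u.
Proof.
elim: n u => [|n IH] /= u; first by rewrite scaler0.
by congr pair => /=; rewrite IH ?scalerN // scalerDr !scalerA mulrC.
Qed.

Lemma koszul_d0 y n : koszul_d y (0 : koszul n) = 0.
Proof. by have := koszul_dZ y 0 (0 : koszul n); rewrite !scale0r. Qed.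

Lemma koszul_dN y n (u : koszul n) : koszul_d y (- u) = - koszul_d y u.
Proof. by rewrite -scaleN1r koszul_dZ scaleN1r. Qed.

Lemma koszul_dB y n (u v : koszul n) :
  koszul_d y (u - v) = koszul_d y u - koszul_d y v.
Proof. by rewrite koszul_dD koszul_dN. Qed.

Lemma koszul_dd y n (u : koszul n) : koszul_d y (koszul_d y u) = 0.
Proof.
elim: n u => [|n IH] //= u.
rewrite koszul_dD koszul_dN koszul_dZ !IH scalerN add0r subrr.
by rewrite !oppr0.
Qed.

Section Inside.
Variables (J : set S) (iJ : is_ideal J).

Lemma koszul_in0 n : koszul_in J (0 : koszul n).
Proof. by elim: n => [|n IH] /=; [exact: (ideal_0 iJ)|split]. Qed.

Lemma koszul_inD n (u v : koszul n) :
  koszul_in J u -> koszul_in J v -> koszul_in J (u + v).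
Proof.
elim: n u v => [|n IH] /= u v; first exact: (ideal_D iJ).
by move=> [u1 u2] [v1 v2]; split; apply: IH.
Qed.

Lemma koszul_inZ n s (u : koszul n) : koszul_in J u -> koszul_in J (s *: u).
Proof.
elim: n u => [|n IH] /= u; first exact: (ideal_M iJ).
by move=> [u1 u2]; split; apply: IH.
Qed.

Lemma koszul_inN n (u : koszul n) : koszul_in J u -> koszul_in J (- u).
Proof. by rewrite -scaleN1r; apply: koszul_inZ. Qed.

Lemma koszul_in_d y n (u : koszul n) : koszul_in J u -> koszul_in J (koszul_d y u).
Proof.
elim: n u => [|n IH] /= u; first by move=> _; exact: (ideal_0 iJ).
move=> [u1 u2]; split; last by apply: koszul_inN; apply: IH.
by apply: koszul_inD; [exact: IH|exact: koszul_inZ].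
Qed.

Lemma koszul_in_sub n (u v : koszul n) :
  koszul_in J (u - v) -> koszul_in J v -> koszul_in J u.
Proof. by move=> Juv Jv; rewrite -(subrK v u); apply: koszul_inD. Qed.

Lemma koszul_in_subr n (u v : koszul n) :
  koszul_in J (u - v) -> koszul_in J u -> koszul_in J v.
Proof.
by move=> Juv; apply: koszul_in_sub; rewrite -opprB; apply: koszul_inN.
Qed.

End Inside.

Lemma koszul_in_sub_ideal J K n (u : koszul n) : J `<=` K ->
  koszul_in J u -> koszul_in K u.
Proof.
move=> JK; elim: n u => [|n IH] /= u; first exact: JK.
by move=> [u1 u2]; split; apply: IH.
Qed.

Lemma koszul_in_colon J s n (u : koszul n) :
  koszul_in (colon J s) u <-> koszul_in J (s *: u).
Proof.
elim: n u => [|n IH] /= u; first by rewrite /colon /= mulrC.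
by split=> -[/IH ? /IH ?]; split.
Qed.

Lemma koszul_in_all n (u : koszul n) : koszul_in setT u.
Proof. by elim: n u => [|n IH] //= u. Qed.

Lemma koszul_deg0 i n : koszul_deg i (0 : koszul n).
Proof.
elim: n i => [|n IH] /= i; first by right.
by split => //; case: i => // i; exact: IH.
Qed.

Lemma koszul_degD i n (u v : koszul n) :
  koszul_deg i u -> koszul_deg i v -> koszul_deg i (u + v).
Proof.
elim: n i u v => [|n IH] /= i u v.
  by move=> [->|->]; [left|rewrite add0r].
move=> [u1 u2] [v1 v2]; split; first exact: IH.
by case: i u1 u2 v1 v2 => [|i] _ u2 _ v2; [rewrite u2 v2 addr0|exact: IH].
Qed.

Lemma koszul_degZ i n s (u : koszul n) : koszul_deg i u -> koszul_deg i (s *: u).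
Proof.
elim: n i u => [|n IH] /= i u.
  by move=> [->|->]; [left|right; rewrite scaler0].
move=> [u1 u2]; split; first exact: IH.
by case: i u1 u2 => [|i] _ u2; [rewrite u2 scaler0|exact: IH].
Qed.

Lemma koszul_degN i n (u : koszul n) : koszul_deg i u -> koszul_deg i (- u).
Proof. by rewrite -scaleN1r; apply: koszul_degZ. Qed.

Lemma koszul_degB i n (u v : koszul n) :
  koszul_deg i u -> koszul_deg i v -> koszul_deg i (u - v).
Proof. by move=> ? ?; apply: koszul_degD => //; apply: koszul_degN. Qed.

Lemma koszul_d_deg0 y n (u : koszul n) : koszul_deg 0 u -> koszul_d y u = 0.
Proof.
elim: n u => [|n IH] //= u [u1 ->].
by rewrite IH // scaler0 addr0 koszul_d0 oppr0.
Qed.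

Lemma koszul_deg_d y i n (u : koszul n) :
  koszul_deg i.+1 u -> koszul_deg i (koszul_d y u).
Proof.
elim: n i u => [|n IH] /= i u; first by right.
move=> [u1 u2]; split.
  by apply: koszul_degD; [exact: IH|exact: koszul_degZ].
case: i u1 u2 => [|i] _ u2; first by rewrite koszul_d_deg0 ?oppr0.
by apply: koszul_degN; apply: IH.
Qed.

Lemma koszul_deg_top i n (u : koszul n) : (n < i)%N -> koszul_deg i u -> u = 0.
Proof.
elim: n i u => [|n IH] [|i] //= u; first by move=> _ [].
case: u => a b; rewrite ltnS => ni [/= /IH a0 /IH b0].
by congr pair; [apply/a0/leqW|exact: b0].
Qed.

Lemma koszul_in_adjoin J s i n (u : koszul n) : is_ideal J ->
  koszul_deg i u -> koszul_in (adjoin J s) u ->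
  exists2 e, koszul_deg i e & koszul_in J (u - s *: e).
Proof.
move=> iJ; elim: n i u => [|n IH] /= i u.
  move=> [-> [a Ja]|-> _]; first by exists a; [left|rewrite /= -[_ *: _]/(s * a) mulrC].
  by exists 0; [right|rewrite scaler0 subr0; exact: (ideal_0 iJ)].
move=> [u1 u2] [/(IH _ _ u1)[e1 d1 J1]].
case: i u1 u2 d1 => [|i] u1 u2 d1.
  move=> _; exists (e1, 0) => //=; split=> //=.
  by rewrite u2 scaler0 subr0; exact: koszul_in0.
by move=> /(IH _ _ u2)[e2 d2 J2]; exists (e1, e2).
Qed.

(** ** Degrees zero and one *)

Fixpoint koszul_inj0 n (r : S) : koszul n :=
  match n with 0 => r | n'.+1 => (koszul_inj0 n' r, 0) end.

Fixpoint koszul_coef0 n : koszul n -> S :=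
  match n with 0 => fun v => v | n'.+1 => fun v => koszul_coef0 v.1 end.

Fixpoint koszul_inj1 n (r : nat -> S) : koszul n :=
  match n with 0 => 0 | n'.+1 => (koszul_inj1 n' r, koszul_inj0 n' (r n')) end.

Fixpoint koszul_coef1 j n : koszul n -> S :=
  match n with
  | 0 => fun=> 0
  | n'.+1 => fun v => if j == n' then koszul_coef0 v.2 else koszul_coef1 j v.1
  end.

Lemma koszul_inj0_deg n r : koszul_deg 0 (koszul_inj0 n r).
Proof. by elim: n => [|n IH] /=; [left|]. Qed.

Lemma koszul_inj1_deg n (r : nat -> S) : koszul_deg 1 (koszul_inj1 n r).
Proof. by elim: n => [|n IH] /=; [right|split=> //; exact: koszul_inj0_deg]. Qed.

Lemma koszul_inj0K n (u : koszul n) :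
  koszul_deg 0 u -> koszul_inj0 n (koszul_coef0 u) = u.
Proof.
by elim: n u => [|n IH] //= -[u1 u2] /= [d1 ->]; rewrite IH.
Qed.

Lemma koszul_inj0D n r s :
  koszul_inj0 n (r + s) = koszul_inj0 n r + koszul_inj0 n s.
Proof.
by elim: n => [|n IH] //=; rewrite IH; congr pair => /=; rewrite addr0.
Qed.

Lemma koszul_inj0Z n r s : koszul_inj0 n (r * s) = r *: koszul_inj0 n s.
Proof.
by elim: n => [|n IH] //=; rewrite IH; congr pair => /=; rewrite scaler0.
Qed.

Lemma koszul_inj0_in J n r : is_ideal J -> J r -> koszul_in J (koszul_inj0 n r).
Proof. by move=> iJ Jr; elim: n => [|n IH] //=; split=> //; exact: koszul_in0. Qed.

Lemma koszul_coef0D n (u v : koszul n) :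
  koszul_coef0 (u + v) = koszul_coef0 u + koszul_coef0 v.
Proof. by elim: n u v => [|n IH] //= u v; rewrite IH. Qed.

Lemma koszul_coef0Z n s (u : koszul n) :
  koszul_coef0 (s *: u) = s * koszul_coef0 u.
Proof. by elim: n u => [|n IH] //= u; rewrite IH. Qed.

Lemma koszul_coef0_in J n (u : koszul n) : koszul_in J u -> J (koszul_coef0 u).
Proof. by elim: n u => [|n IH] //= u [/IH]. Qed.

Lemma koszul_coef1D j n (u v : koszul n) :
  koszul_coef1 j (u + v) = koszul_coef1 j u + koszul_coef1 j v.
Proof.
elim: n u v => [|n IH] //= u v; first by rewrite addr0.
by case: eqP => _; [exact: koszul_coef0D|exact: IH].
Qed.

Lemma koszul_coef1Z j n s (u : koszul n) :
  koszul_coef1 j (s *: u) = s * koszul_coef1 j u.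
Proof.
elim: n u => [|n IH] //= u; first by rewrite mulr0.
by case: eqP => _; [exact: koszul_coef0Z|exact: IH].
Qed.

Lemma koszul_coef1_in J j n (u : koszul n) : is_ideal J ->
  koszul_in J u -> J (koszul_coef1 j u).
Proof.
move=> iJ; elim: n u => [|n IH] //= u; first by move=> _; exact: (ideal_0 iJ).
by move=> [u1 u2]; case: eqP => _; [exact: koszul_coef0_in|exact: IH].
Qed.

Lemma koszul_coef0_inj0 n r : koszul_coef0 (koszul_inj0 n r) = r.
Proof. by elim: n. Qed.

Lemma koszul_coef1_inj1 j n (r : nat -> S) : (j < n)%N ->
  koszul_coef1 j (koszul_inj1 n r) = r j.
Proof.
elim: n => //= n IH; rewrite ltnS leq_eqVlt.
by case: eqP => [->|_ /= jn]; [rewrite koszul_coef0_inj0|exact: IH].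
Qed.

Lemma koszul_d_inj1 y n (r : nat -> S) :
  koszul_d y (koszul_inj1 n r) = koszul_inj0 n (\sum_(i < n) r i * y i).
Proof.
elim: n => [|n IH] /=; first by rewrite big_ord0.
rewrite IH koszul_d_deg0 ?oppr0; last exact: koszul_inj0_deg.
by rewrite big_ord_recr /= koszul_inj0D -koszul_inj0Z [y n * _]mulrC.
Qed.

Lemma koszul_coef0_d y n (u : koszul n) K : is_ideal K ->
  (forall i, (i < n)%N -> K (y i)) -> K (koszul_coef0 (koszul_d y u)).
Proof.
move=> iK; elim: n u => [|n IH] /= u Ky; first exact: (ideal_0 iK).
rewrite koszul_coef0D koszul_coef0Z; apply: ideal_D => //.
  by apply: IH => i it; apply/Ky/ltnW.
by apply: ideal_Mr => //; exact: Ky.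
Qed.

(** Boundaries in degree one are the trivial relations, whose [j]-th coefficient
    lies in the ideal of the entries other than [y j]. *)
Lemma koszul_coef1_d y j n (u : koszul n) K : is_ideal K ->
  (forall i, (i < n)%N -> i <> j -> K (y i)) -> K (koszul_coef1 j (koszul_d y u)).
Proof.
move=> iK; elim: n u => [|n IH] /= u Ky; first exact: (ideal_0 iK).
case: eqP => [jn|jn].
  rewrite -scaleN1r koszul_coef0Z; apply: ideal_M => //.
  apply: koszul_coef0_d => // i it; apply: Ky; first exact: ltnW.
  by move=> ij; rewrite ij jn ltnn in it.
rewrite koszul_coef1D koszul_coef1Z; apply: ideal_D => //.
  by apply: IH => i it; apply/Ky/ltnW.
by apply: ideal_Mr => //; apply: Ky => // /esym.
Qed.

Definition regular_upto J y n := forall t : nat, (t < n)%N ->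
  regular_mod (iteri t (fun i K => adjoin K (y i)) J) (y t).

Section Acyclic.
Variables (J : set S) (y : nat -> S).
Hypothesis iJ : is_ideal J.
Let E (t : nat) := iteri t (fun i K => adjoin K (y i)) J.

Let iE (t : nat) : is_ideal (E t).
Proof. by elim: t => // t IH; exact: adjoin_ideal. Qed.

Let E_y (t i : nat) : (i < t)%N -> E t (y i).
Proof.
elim: t => // t IH; rewrite ltnS leq_eqVlt => /predU1P[->|/IH Eyi].
  exact: (adjoin_self _ (iE t)).
exact: (sub_adjoin _ (iE t)).
Qed.

Let J_E (t : nat) : J `<=` E t.
Proof.
elim: t => // t IH; apply: (subset_trans IH); exact: (sub_adjoin _ (iE t)).
Qed.

(** In degree zero the boundaries are the multiples of the entries, [E n] modulo [J]. *)
Lemma koszul_boundary0 n r : E n r ->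
  exists2 u : koszul n, koszul_deg 1 u & koszul_in J (koszul_inj0 n r - koszul_d y u).
Proof.
elim: n r => [|n IH] r /=.
  by move=> Jr; exists 0; [right|rewrite subr0].
move=> [a Era]; have [u u1 Ju] := IH _ Era.
exists (u, koszul_inj0 n a) => /=; first by split=> //; exact: koszul_inj0_deg.
rewrite (koszul_d_deg0 _ (koszul_inj0_deg n a)) oppr0; split=> /=; last first.
  by rewrite subr0; exact: koszul_in0.
move: Ju; rewrite -mulNr mulrC koszul_inj0D koszul_inj0Z.
rewrite -[koszul_inj0 n (- a)]/(koszul_inj0 n (- a)) -mulN1r koszul_inj0Z scaleN1r.
by rewrite scalerN opprD addrA addrAC.
Qed.

(** For a cycle [(a, b)] of the cone, [b] is a cycle of the smaller complex, hence
    a boundary; subtracting the corresponding boundary leaves [b = 0] and a cycle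
    [a]. Only if [b] has degree zero is the regularity of [y n] used: then
    [y n * b] is a boundary, so [b] is one. *)
Lemma koszul_acyclic n i (u : koszul n) : regular_upto J y n ->
  koszul_deg i.+1 u -> koszul_in J (koszul_d y u) ->
  exists2 v, koszul_deg i.+2 v & koszul_in J (u - koszul_d y v).
Proof.
elim: n i u => [|n IH] i u ry.
  move=> [//|->] _; exists 0; first exact: koszul_deg0.
  by rewrite koszul_d0 subr0; exact: (ideal_0 iJ).
have ryn : regular_upto J y n by move=> t tn; apply/ry/ltnW.
case: u => a b /= [da db] [Ja /(koszul_inN iJ)]; rewrite opprK => Jb.
have [b' db' Jb'] : exists2 b', koszul_deg i.+1 b' & koszul_in J (b - koszul_d y b').
  case: i da db => [da db|i da db]; last exact: IH.
  rewrite -(koszul_inj0K db); apply: koszul_boundary0; apply: (ry n (ltnSn n)).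
  have := koszul_coef0_in Ja; rewrite koszul_coef0D koszul_coef0Z => /J_E Ea.
  apply: (ideal_subr (iE n) _ (Ea n)); rewrite addrK.
  by apply: koszul_coef0_d => // j; exact: E_y.
have [|||a' da' Ja'] := IH i (a + y n *: b').
- exact: ryn.
- by apply: koszul_degD => //; exact: koszul_degZ.
- rewrite koszul_dD koszul_dZ; apply: (koszul_in_subr iJ _ Ja).
  by rewrite opprD addrACA subrr add0r -scalerBr; exact: koszul_inZ.
exists (a', - b') => /=; first by split=> //; exact: koszul_degN.
by split=> /=; rewrite ?koszul_dN ?opprK // scalerN opprB addrA.
Qed.

End Acyclic.
End Koszul.

(** * Uniform annihilation of Koszul homology *)

Section UniformAnnihilator.
Variables (S : comNzRingType) (I J0 : set S) (d : nat).
Implicit Types (J K P Q A : set S) (c r s t x : S) (y : nat -> S) (i : nat).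
Hypotheses (mc : maximal_condition S).
Hypotheses (iI : is_ideal I) (iJ0 : is_ideal J0) (J0I : J0 `<=` I).
Hypothesis minI_J0 : forall P, minimal_over I P -> minimal_over J0 P.

(** The preimage of the complement of the minimal primes of [S/I]. *)
Definition avoids_minimal c := forall P, minimal_over I P -> ~ P c.

Lemma avoids_minimal1 : avoids_minimal 1.
Proof. by move=> P [pP _ _]; exact: prime_1. Qed.

Lemma avoids_minimalM a b :
  avoids_minimal a -> avoids_minimal b -> avoids_minimal (a * b).
Proof. by move=> na nb P mP; have [pP _ _] := mP => /(prime_M pP)[/na|/nb]; apply. Qed.

(** Uniform annihilation of the Koszul homology [H_i(y; S/J)]; chains with
    coefficients in [S/J] are represented by their lifts to [S]. *)
Definition annihilated i J := exists2 c, avoids_minimal c &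
  forall y, regular_upto J0 y d -> forall u : koszul S d, koszul_deg i u ->
  koszul_in J (koszul_d y u) ->
  exists2 v, koszul_deg i.+1 v & koszul_in J (c *: u - koszul_d y v).

Lemma annihilated_torsion i J c : is_ideal J -> avoids_minimal c -> J c ->
  annihilated i J.
Proof.
move=> iJ nc Jc; exists c => // y _ u _ _; exists 0; first exact: koszul_deg0.
rewrite koszul_d0 subr0; apply/koszul_in_colon.
apply: koszul_in_sub_ideal (koszul_in_all u) => x _; exact: ideal_M.
Qed.

(** The long exact sequence of [0 -> S/(J:s) -> S/J -> S/(J+s) -> 0] at [S/J]. *)
Lemma annihilated_extension i J s : is_ideal J ->
  annihilated i (colon J s) -> annihilated i (adjoin J s) -> annihilated i J.
Proof.
move=> iJ [c1 nc1 H1] [c2 nc2 H2].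
exists (c1 * c2); first exact: avoids_minimalM.
move=> y ry u du Ju.
have [|v dv Jv] := H2 y ry u du.
  by apply: koszul_in_sub_ideal Ju; exact: sub_adjoin.
have [|e de Je] := koszul_in_adjoin iJ _ Jv (i := i).
  by apply: koszul_degB; [exact: koszul_degZ|exact: koszul_deg_d].
have [|w dw Jw] := H1 y ry e de.
  apply/koszul_in_colon.
  have := koszul_in_d iJ y Je.
  rewrite !koszul_dB koszul_dd subr0 !koszul_dZ => Jd.
  by apply: (koszul_in_subr iJ Jd); exact: koszul_inZ.
exists (c1 *: v + s *: w).
  by apply: koszul_degD; exact: koszul_degZ.
move: Jw => /koszul_in_colon; rewrite scalerBr => Jw.
apply: (koszul_in_sub iJ _ Jw).
have -> : c1 * c2 *: u - koszul_d y (c1 *: v + s *: w)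
    - (s *: (c1 *: e) - s *: koszul_d y w)
  = c1 *: (c2 *: u - koszul_d y v - s *: e).
  rewrite koszul_dD !koszul_dZ !scalerBr !scalerA [s * c1]mulrC.
  by rewrite opprB opprD !addrA subrK.
exact: koszul_inZ.
Qed.

(** The same long exact sequence at [S/(J:s)], with [J = J0], whose homology
    vanishes in positive degrees: the connecting map is injective. *)
Lemma annihilated_connecting i s :
  annihilated i.+2 (adjoin J0 s) -> annihilated i.+1 (colon J0 s).
Proof.
move=> [c nc H]; exists c => // y ry u du /koszul_in_colon Ju.
have [||v dv Jv] := koszul_acyclic iJ0 ry (u := s *: u) (i := i).
- exact: koszul_degZ.
- by rewrite koszul_dZ.
have [|w dw Jw] := H y ry v dv.
  apply: (koszul_in_subr (adjoin_ideal s iJ0) (u := s *: u)).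
    by apply: koszul_in_sub_ideal Jv; exact: sub_adjoin.
  apply/koszul_in_colon; apply: koszul_in_sub_ideal (koszul_in_all u) => x _.
  by apply: ideal_M; [exact: adjoin_ideal|exact: adjoin_self].
have [|e de Je] := koszul_in_adjoin iJ0 _ Jw (i := i.+2).
  by apply: koszul_degB; [exact: koszul_degZ|exact: koszul_deg_d].
exists e => //; apply/koszul_in_colon.
have := koszul_in_d iJ0 y Je; rewrite !koszul_dB koszul_dd subr0 !koszul_dZ => Jd.
apply: (koszul_in_sub iJ0 _ Jd).
have -> : s *: (c *: u - koszul_d y e) - (c *: koszul_d y v - s *: koszul_d y e)
        = c *: (s *: u - koszul_d y v).
  by rewrite !scalerBr !scalerA [s * c]mulrC opprB addrA subrK.
exact: koszul_inZ.
Qed.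

(** Descending induction on the degree [i], which starts above [d], and for fixed
    [i] Noetherian induction on [J]. By the first sequence only the quotients
    [S/P], [P] prime, matter. If [P] is not a minimal prime of [I], it contains
    an element avoiding those; otherwise [P = (J0 : s)] and the second sequence
    reduces degree [i] for [S/P] to degree [i+1] for [S/(J0 + s)]. *)
Lemma annihilated_all i J : is_ideal J -> J0 `<=` J -> annihilated i.+1 J.
Proof.
have [k ik] : exists k, (d < i.+1 + k)%N by exists d; rewrite addSn ltnS leq_addl.
elim: k i ik J => [|k IHk] i ik J.
  move=> iJ _; exists 1; first exact: avoids_minimal1.
  move=> y _ u du _; exists 0; first exact: koszul_deg0.
  rewrite addn0 in ik; have -> := koszul_deg_top ik du.
  rewrite koszul_d0 scaler0 subr0.
  exact: koszul_in0.
move: J; apply: (noetherian_ind mc) => J iJ IH J0J.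
have [J1|nJ1] := pselect (J 1).
  by apply: annihilated_torsion J1 => //; exact: avoids_minimal1.
have [|P [pP [s Ps]] _] := @assoc_prime_above S mc J 1 set0 iJ nJ1; first by [].
have nJs : ~ J s by move: (prime_1 pP); rewrite Ps /colon /= mul1r.
apply: (@annihilated_extension _ _ s iJ); last first.
  apply: IH; [exact: adjoin_ideal|exact: sub_adjoin| |].
    by move=> /(_ s (adjoin_self s iJ)).
  by apply: subset_trans J0J _; exact: sub_adjoin.
rewrite -Ps; have J0P : J0 `<=` P.
  by apply: (subset_trans J0J); rewrite Ps => x Jx; exact: ideal_Mr.
have [mP|nmP] := pselect (minimal_over I P).
  have [_ [t ->]] := minimal_over_assoc mc iJ0 (minI_J0 mP).
  apply: annihilated_connecting; apply: IHk.
  - by rewrite addSnnS.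
  - exact: adjoin_ideal.
  - exact: sub_adjoin.
have [L LP] := assoc_primes_finite mc iJ0.
have [r Pr rP] := coset_prime_avoidance 0 L (prime_ideal pP).
rewrite add0r in rP.
apply: annihilated_torsion Pr; first exact: prime_ideal.
move=> Q mQ; have mQ0 := minI_J0 mQ; have [pQ IQ minQ] := mQ.
apply: rP => //; first by apply: LP; exact: minimal_over_assoc.
move=> [_ PQ]; apply: nmP; have [_ _ /(_ P pP J0P PQ) QP] := mQ0.
suff -> : P = Q by [].
exact/seteqP.
Qed.

(** A relation modulo [I] is a cycle of degree one on [S/I], and after
    multiplication by [c] it becomes a trivial relation. *)
Lemma relation_annihilator : exists2 c, avoids_minimal c &
  forall y, regular_upto J0 y d -> forall (r : nat -> S) K j, is_ideal K ->
    I `<=` K -> I (\sum_(i < d) r i * y i) -> (j < d)%N ->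
    (forall i, (i < d)%N -> i <> j -> K (y i)) -> K (c * r j).
Proof.
have [c nc H] := annihilated_all 0 iI J0I.
exists c => // y ry r K j iK IK Ir jd Ky.
have [||v dv Jv] := H y ry (koszul_inj1 d r) _ _.
- exact: koszul_inj1_deg.
- by rewrite koszul_d_inj1; exact: koszul_inj0_in.
have := IK _ (koszul_coef1_in j iI Jv).
rewrite koszul_coef1D koszul_coef1Z koszul_coef1_inj1 // => Kc.
apply: (ideal_sub iK (y := koszul_coef1 j (koszul_d y v))).
  by rewrite -scaleN1r koszul_coef1Z mulN1r in Kc.
exact: koszul_coef1_d.
Qed.

End UniformAnnihilator.

(** * Ideals as sets and as structures *)

Section IdealStructure.
Variables (R : comNzRingType) (I : set R) (iI : is_ideal I).

Definition ideal_pred of is_ideal I : {pred R^o} := fun x => `[< I x >].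

Fact ideal_pred_closed : GRing.subsemimod_closed (ideal_pred iI).
Proof.
split; first split.
- by apply/asboolP; exact: (ideal_0 iI).
- by move=> x y /asboolP Ix /asboolP Iy; apply/asboolP; exact: (ideal_D iI).
- by move=> a x /asboolP Ix; apply/asboolP; exact: (ideal_M iI).
Qed.

HB.instance Definition _ :=
  GRing.isSubmodClosed.Build R R^o (ideal_pred iI) ideal_pred_closed.

Definition ideal_of_set : ideal R := ideal_pred iI.

Lemma ideal_of_setE x : (x \in ideal_of_set) <-> I x.
Proof. by split=> /asboolP. Qed.
End IdealStructure.

Section PrimeStructure.
Variables (R : comNzRingType) (P : set R).

Definition idealr_pred of is_ideal P & ~ P 1 : {pred R} := fun x => `[< P x >].

Fact idealr_pred_closed iP P1 : idealr_closed (@idealr_pred iP P1).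
Proof.
split.
- by apply/asboolP; exact: (ideal_0 iP).
- by apply/asboolP.
- move=> a x y /asboolP Px /asboolP Py; apply/asboolP.
  by apply: (ideal_D iP) => //; exact: (ideal_M iP).
Qed.

HB.instance Definition _ iP P1 :=
  isIdealr.Build R (@idealr_pred iP P1) (@idealr_pred_closed iP P1).

Definition idealr_of_set iP P1 : idealr R := @idealr_pred iP P1.

Definition prime_pred of is_prime P : {pred R} := fun x => `[< P x >].

Fact prime_pred_idealr pP : idealr_closed (prime_pred pP).
Proof. exact: (@idealr_pred_closed (prime_ideal pP) (@prime_1 _ _ pP)). Qed.

HB.instance Definition _ pP :=
  isIdealr.Build R (prime_pred pP) (prime_pred_idealr pP).

Fact prime_pred_prime pP : prime_idealr_closed (prime_pred pP).
Proof.
by move=> u v /asboolP/(prime_M pP)[Pu|Pv]; apply/orP; [left|right]; apply/asboolP.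
Qed.

HB.instance Definition _ pP :=
  isPrimeIdealrClosed.Build R (prime_pred pP) (@prime_pred_prime pP).

Definition prime_of_set pP : prime_idealr R := prime_pred pP.

Lemma prime_of_setE pP : [set` prime_of_set pP] = P.
Proof. by apply/seteqP; split=> x /asboolP. Qed.

Lemma idealr_of_setE iP P1 : [set` @idealr_of_set iP P1] = P.
Proof. by apply/seteqP; split=> x /asboolP. Qed.

End PrimeStructure.

Section IdealBridges.
Variable R : comNzRingType.

Lemma set_ideal (I : ideal R) : @is_ideal R [set` I].
Proof.
split; first exact: rpred0.
- by move=> x y; exact: rpredD.
- by move=> a x; exact: ideal_mulr.
Qed.

Lemma set_idealr (I : idealr R) : is_ideal [set` I].
Proof.
split; first exact: rpred0.
- by move=> x y; exact: rpredD.
- by move=> a x; exact: idealMr.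
Qed.

Lemma set_prime (P : prime_idealr R) : is_prime [set` P].
Proof.
split; first exact: set_idealr.
- by rewrite /= idealr1.
- by move=> a b; rewrite /= prime_idealrM => /orP.
Qed.

Lemma ideal_spanP (A : set R) (x : R) : x \in ideal_span A <->
  forall J : set R, is_ideal J -> A `<=` J -> J x.
Proof.
split=> [/asboolP xA J iJ AJ|xA].
  by apply/(ideal_of_setE iJ)/xA => y /AJ/(ideal_of_setE iJ).
by apply/asboolP => J AJ; exact: (xA [set` J] (set_ideal J) AJ).
Qed.

Lemma sub_ideal_span (A : set R) : A `<=` [set` ideal_span A].
Proof. by move=> x Ax; apply/ideal_spanP => J _; apply. Qed.

Lemma ideal_span_rangeP d (y : 'I_d -> R) (x : R) :
  x \in ideal_span (range y) <-> exists a : 'I_d -> R, x = \sum_i a i * y i.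
Proof.
split=> [|[a ->]].
  pose C : set R := [set z | exists a : 'I_d -> R, z = \sum_i a i * y i].
  move=> /ideal_spanP xy; apply: (xy C).
    split.
    - by exists (fun=> 0); rewrite big1 // => i _; rewrite mul0r.
    - move=> _ _ [a ->] [b ->]; exists (fun i => a i + b i).
      by rewrite -big_split; apply: eq_bigr => i _; rewrite mulrDl.
    - move=> c _ [a ->]; exists (fun i => c * a i).
      by rewrite mulr_sumr; apply: eq_bigr => i _; rewrite mulrA.
  move=> _ [i _ <-]; exists (fun j => (j == i)%:R).
  rewrite (bigD1 i) //= eqxx mul1r big1 ?addr0 // => j /negPf ->.
  by rewrite mul0r.
apply: rpred_sum => i _; apply: ideal_mulr; apply: sub_ideal_span.
by exists i.
Qed.

Lemma noetherian_maximal_condition : noetherian R -> maximal_condition R.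
Proof.
move=> noeth F [J0 FJ0] Fi; apply: contrapT => nmax.
have step (J : {J | F J}) : exists K : {K | F K},
    sval J `<=` sval K /\ ~ sval K `<=` sval J.
  apply: contrapT => nK; apply: nmax; exists (sval J); first exact: svalP.
  move=> K FK JK; apply: contrapT => nKJ; apply: nK.
  by exists (exist _ K FK).
have [f fP] := choice step.
pose u k := iter k f (exist _ J0 FJ0).
have iu k : is_ideal (sval (u k)) by apply/Fi/svalP.
have umono i j : (i <= j)%N -> sval (u i) `<=` sval (u j).
  move=> /subnK <-; elim: (j - i)%N => // k IH.
  by apply: (subset_trans IH); case: (fP (u (k + i)%N)).
pose U := [set x | exists k, sval (u k) x].
have iU : is_ideal U.
  split.
  - by exists 0%N; exact: (ideal_0 (iu 0%N)).
  - move=> x y [k kx] [l ly]; exists (maxn k l).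
    by apply: (ideal_D (iu _)); [apply: umono kx|apply: umono ly];
      rewrite ?leq_maxl ?leq_maxr.
  - by move=> a x [k kx]; exists k; exact: (ideal_M (iu k)).
have [s] := noeth (ideal_of_set iU).
have -> : [set` ideal_of_set iU] = U.
  by apply/seteqP; split=> x /(ideal_of_setE iU).
move=> Us.
have [k sk] : exists k, forall x, x \in s -> sval (u k) x.
  have : forall x, x \in s -> U x.
    by move=> x xs; rewrite Us; apply: sub_ideal_span.
  elim: s {Us} => [|x s IH] sU; first by exists 0%N.
  have [|k ks] := IH; first by move=> z zs; apply: sU; rewrite inE zs orbT.
  have [|l lx] := sU x; first by rewrite inE eqxx.
  exists (maxn k l) => z; rewrite inE => /predU1P[->|/ks].
    by apply: umono lx; rewrite leq_maxr.
  by apply: umono; rewrite leq_maxl.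
have [_] := fP (u k); apply=> x ux.
have : U x by exists k.+1.
by rewrite Us /= => /ideal_spanP xs; exact: (xs (sval (u k))).
Qed.

End IdealBridges.

(** * Chains of ideals and length *)

Section NatSup.
Implicit Types A B : set nat.

Lemma nat_sup_max A (n : nat) : A n -> (forall k, A k -> (k <= n)%N) ->
  nat_sup A = n%:Z%:E.
Proof.
move=> An Amax; rewrite /nat_sup /supremum ifF; last first.
  by apply/eqP => /seteqP[/(_ n%:Z%:E) H _]; apply: H; exists n.
have supn : supremums [set k%:Z%:E | k in A] n%:Z%:E.
  split=> [_ [k Ak <-]|y]; first by rewrite lee_fin lez_nat; exact: Amax.
  by apply; exists n.
case: xgetP => [y _ supy|/(_ n%:Z%:E)//]; exact: (is_subset1_supremums supy supn).
Qed.

Lemma nat_sup_pinfty A : (forall n, exists2 k, A k & (n < k)%N) ->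
  nat_sup A = +oo%E.
Proof.
move=> unb; rewrite /nat_sup /supremum ifF; last first.
  have [k Ak _] := unb 0%N.
  by apply/eqP => /seteqP[/(_ k%:Z%:E) H _]; apply: H; exists k.
have supy : supremums [set k%:Z%:E | k in A] +oo%E.
  split=> [y _|y uby]; first exact: leey.
  case: y uby => [z uby||uby] //.
    have [k Ak zk] := unb `|z|%N.
    have /uby : [set k%:Z%:E | k in A] k%:Z%:E by exists k.
    rewrite lee_fin => kz; have : (k%:Z <= `|z|%N%:Z)%R.
      by apply: (le_trans kz); rewrite abszE ler_norm.
    by rewrite lez_nat leqNgt zk.
  have [k Ak _] := unb 0%N.
  by have /uby : [set k%:Z%:E | k in A] k%:Z%:E by exists k.
case: xgetP => [y _ sy|/(_ +oo%E)//]; exact: (is_subset1_supremums sy supy).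
Qed.

Lemma nat_sup_dichotomy A : A !=set0 ->
  (exists n, [/\ A n, forall k, A k -> (k <= n)%N & nat_sup A = n%:Z%:E]) \/
  (forall n, exists2 k, A k & (n < k)%N) /\ nat_sup A = +oo%E.
Proof.
move=> [a Aa]; have [unb|] := pselect (forall n, exists2 k, A k & (n < k)%N).
  by right; split=> //; exact: nat_sup_pinfty.
move=> /existsNP[N nN]; left.
have AN k : `[< A k >] -> (k <= N)%N.
  by move=> /asboolP Ak; rewrite leqNgt; apply/negP => Nk; apply: nN; exists k.
have [|n /asboolP An nmax] := @ex_maxnP (fun k => `[< A k >]) N _ AN.
  by exists a; apply/asboolP.
have max k : A k -> (k <= n)%N by move=> Ak; apply/nmax/asboolP.
by exists n; split=> //; exact: nat_sup_max.
Qed.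

Lemma nat_sup_fin A (n : nat) : nat_sup A = n%:Z%:E ->
  A n /\ forall k, A k -> (k <= n)%N.
Proof.
have [->|/set0P A0] := eqVneq A set0.
  by rewrite /nat_sup image_set0 supremum0.
case: (nat_sup_dichotomy A0) => [[k [Ak maxk ->]]|[_ ->//]].
by move=> -[<-].
Qed.

Lemma nat_sup_mul A B (c : nat) : (0 < c)%N -> A 0%N ->
  (forall n, A n -> B (c * n)%N) -> (c%:Z%:E * nat_sup A <= nat_sup B)%E.
Proof.
move=> c0 A0 AB; have B0 : B 0%N by rewrite -(muln0 c); exact: AB.
have {A0 B0}[A0 B0] : A !=set0 /\ B !=set0 by split; exists 0%N.
case: (nat_sup_dichotomy B0) => [[N [BN maxN ->]]|[_ ->]]; last exact: leey.
case: (nat_sup_dichotomy A0) => [[n [An maxn ->]]|[unb _]].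
  by rewrite -EFinM lee_fin -PoszM lez_nat; apply/maxN/AB.
have [k Ak Nk] := unb N; have := maxN _ (AB k Ak).
by rewrite leqNgt (leq_trans Nk) // leq_pmull.
Qed.

End NatSup.

Section Chains.
Variable R : comNzRingType.
Implicit Types (A B C E I J K : set R).

(** The ends [A] and [C] only enclose the chain; chains can then be concatenated
    without matching their ends exactly. *)
Fixpoint chain l A C : Prop :=
  if l is l'.+1 then exists I J, [/\ is_ideal I, is_ideal J, A `<=` I,
      I `<` J & chain l' J C]
  else A `<=` C.

Lemma chain_subl l A B C : A `<=` B -> chain l B C -> chain l A C.
Proof.
case: l => [|l] /= AB; first exact: subset_trans.
move=> [I [J [iI iJ BI IJ c]]]; exists I, J; split=> //.
exact: subset_trans BI.
Qed.

Lemma chain_subr l A B C : B `<=` C -> chain l A B -> chain l A C.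
Proof.
move=> BC; elim: l A => [|l IH] A /=; first by move/subset_trans; apply.
by move=> [I [J [iI iJ AI IJ /IH c]]]; exists I, J.
Qed.

Lemma chain_cat l k A B C : chain l A B -> chain k B C -> chain (l + k) A C.
Proof.
elim: l A => [|l IH] A /=; first exact: chain_subl.
by move=> [I [J [iI iJ AI IJ /IH c]]] /c; exists I, J.
Qed.

Lemma chain_seq l A : is_ideal A -> chain l A setT ->
  exists N : nat -> set R, [/\ forall i, is_ideal (N i), forall i, A `<=` N i &
    forall i, (i < l)%N -> N i `<` N i.+1].
Proof.
elim: l A => [|l IH] A iA /=.
  by move=> _; exists (fun=> A); split=> // i x.
move=> [I [J [iI iJ AI IJ /(IH _ iJ)[N [iN JN sN]]]]].
exists (fun i => if i is i'.+1 then N i' else I); split.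
- by case.
- case=> // i; apply: subset_trans (JN i); exact: subset_trans IJ.1.
- case=> [_|i /sN//]; split; first exact: (subset_trans IJ.1).
  by move=> NI; apply: IJ.2; apply: subset_trans NI.
Qed.

Lemma seq_chain l (N : nat -> set R) : (forall i, is_ideal (N i)) ->
  (forall i, (i < l)%N -> N i `<` N i.+1) ->
  chain l (N 0%N) setT.
Proof.
elim: l N => [|l IH] N iN sN //=.
exists (N 0%N), (N 1%N); split=> //; first exact: sN.
by apply: (IH (fun i => N i.+1)) => // i il; exact: sN.
Qed.

End Chains.

Section QuotientIdeals.
Variables (R : comNzRingType) (N : ideal R).
Implicit Types (L : set R) (x : R^o).
Local Notation V := (R^o /% N).

Let pi x : V := \pi_V x.

Let piK (y : V) : pi (repr y) = y. Proof. exact: reprK. Qed.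
Let pi0 : pi 0 = 0. Proof. exact: raddf0. Qed.
Let piB x x' : pi (x - x') = pi x - pi x'. Proof. exact: raddfB. Qed.
Let piD x x' : pi (x + x') = pi x + pi x'. Proof. exact: raddfD. Qed.
Let piZ (a : R) x : pi (a *: x) = a *: pi x.
Proof. by rewrite -[a *: pi x]/(lmod_quot_scale a (pi x)) lmod_quot_scale_pi. Qed.

Lemma quot_pi_eq x x' : pi x = pi x' -> x - x' \in N.
Proof.
move=> e; have : x - x' \in @submod_pred R R^o N.
  by rewrite Quotient.idealrBE; apply/eqP.
by [].
Qed.

Lemma quot_pi_in x : x \in N -> pi x = 0.
Proof.
move=> Nx; rewrite -pi0; apply/eqP; rewrite /pi.
have : x - 0 \in @submod_pred R R^o N by rewrite subr0.
by rewrite Quotient.idealrBE.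
Qed.

Definition quot_ideal_pred L of is_ideal L & [set` N] `<=` L : {pred V} :=
  fun y => `[< L (repr y) >].

Lemma quot_ideal_predE L iL NL x : pi x \in @quot_ideal_pred L iL NL <-> L x.
Proof.
have Nx : L (repr (pi x) - x) by apply/NL/quot_pi_eq; rewrite piK.
split=> [/asboolP|Lx]; first exact: (ideal_subr iL Nx).
by apply/asboolP; exact: (ideal_sub iL Nx).
Qed.

Fact quot_ideal_closed L iL NL :
  GRing.subsemimod_closed (@quot_ideal_pred L iL NL).
Proof.
split; first split.
- by rewrite -pi0; apply/quot_ideal_predE; exact: (ideal_0 iL).
- move=> y z; rewrite -[y]piK -[z]piK -piD => /quot_ideal_predE Ly /quot_ideal_predE Lz.
  by apply/quot_ideal_predE; exact: (ideal_D iL).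
- move=> a y; rewrite -[y]piK -piZ => /quot_ideal_predE Ly.
  by apply/quot_ideal_predE; exact: (ideal_M iL).
Qed.

HB.instance Definition _ L iL NL :=
  GRing.isSubmodClosed.Build R V (@quot_ideal_pred L iL NL)
    (@quot_ideal_closed L iL NL).

Definition quot_ideal L iL NL : submodClosed V := @quot_ideal_pred L iL NL.

(** The ideals of [R/N] are the ideals of [R] above [N]. *)
Lemma chain_length l :
  (exists M : nat -> submodClosed V,
     forall i, (i < l)%N -> [set` M i] `<` [set` M i.+1]) <->
  @chain R l [set` N] setT.
Proof.
split=> [[M sM]|].
  pose L i : set R := [set x | pi x \in M i].
  have iL i : is_ideal (L i).
    split; rewrite /L /=.
    - by rewrite pi0 rpred0.
    - by move=> x y Mx My; rewrite piD rpredD.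
    - by move=> a x Mx; rewrite -[a * x]/(a *: (x : R^o)) piZ rpredZ.
  apply: (@chain_subl _ _ _ (L 0%N)).
    by move=> x Nx; rewrite /L /= quot_pi_in ?rpred0.
  apply: seq_chain => // i il; have [sub nsub] := sM i il.
  split; first by move=> x; exact: sub.
  move=> s10; apply: nsub => y My; rewrite /= -[y]piK.
  by apply: s10; rewrite /L /= piK.
move=> /(chain_seq (set_ideal N))[L [iL NL sL]].
exists (fun i => quot_ideal (iL i) (NL i)) => i il.
have [sub nsub] := sL i il; split=> [y|s10].
  by rewrite /= -[y]piK => /quot_ideal_predE Ly; apply/quot_ideal_predE/sub.
apply: nsub => x Lx; apply/(quot_ideal_predE (iL i) (NL i)).
exact/s10/quot_ideal_predE.
Qed.

End QuotientIdeals.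

Lemma le_length (R : comNzRingType) (N M : ideal R) (c : nat) : (0 < c)%N ->
  (forall l, @chain R l [set` N] setT -> @chain R (c * l) [set` M] setT) ->
  (c%:Z%:E * length (R^o /% N) <= length (R^o /% M))%E.
Proof.
move=> c0 NM; apply: nat_sup_mul => // [|l /chain_length/NM/chain_length//].
by apply/chain_length.
Qed.

(** * Colon capturing and the length inequality *)

Section TightClosureChains.
Variables (R : comNzRingType) (m : set R) (p : nat) (pR : p \in [pchar R]) (d : nat).
Implicit Types (y : 'I_d -> R) (A B C K L Q : set R) (j : 'I_d).

(** When [d] is the dimension, a system of parameters; primes suffice to express
    this because only the radical of the ideal matters. *)
Definition parameters y := (forall i, m (y i)) /\
  forall Q, is_prime Q -> (forall i, Q (y i)) -> m `<=` Q.

Definition colon_killer c := forall y (r : 'I_d -> R) j K, parameters y ->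
  is_ideal K -> \sum_i r i * y i = 0 -> (forall i, i != j -> K (y i)) -> K (c * r j).

Lemma parametersX y (n : 'I_d -> nat) : is_ideal m ->
  (forall i, (0 < n i)%N) -> parameters y -> parameters (fun i => y i ^+ n i).
Proof.
move=> im n0 [my yQ]; split.
  by move=> i; rewrite -(prednK (n0 i)) exprS; apply: ideal_Mr.
by move=> Q pQ Qy; apply: yQ => // i; exact: prime_X (Qy i).
Qed.

Local Notation TC y := (tight_closure pR (ideal_span (range y))).

(** Additivity of Frobenius. *)
Lemma bracket_power_span y e (z : R) :
  z \in bracket_power (ideal_span (range y)) (p ^ e) <->
  exists a : 'I_d -> R, z = \sum_i a i * y i ^+ (p ^ e).
Proof.
have sumX (F : 'I_d -> R) : (\sum_i F i) ^+ (p ^ e) = \sum_i F i ^+ (p ^ e).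
  have pe : [pchar R].-nat (p ^ e)%N.
    by rewrite pnatX (eq_pnat _ (pcharf_eq pR)) pnat_id ?(pcharf_prime pR).
  elim/big_rec2: _ => [|i a b _ <-].
    rewrite expr0n expn_eq0.
    by have /prime_gt0 := pcharf_prime pR; case: p.
  exact: exprDn_pchar.
split=> [/ideal_spanP zI|[a ->]].
  apply/(ideal_span_rangeP (fun i => y i ^+ (p ^ e))).
  apply: (zI [set` ideal_span (range (fun i => y i ^+ (p ^ e)))] (set_ideal _)).
  move=> _ [x /ideal_span_rangeP[a ->] <-].
  apply/ideal_span_rangeP; exists (fun i => a i ^+ (p ^ e)).
  by rewrite sumX; apply: eq_bigr => i _; rewrite exprMn.
apply: rpred_sum => i _; apply: ideal_mulr; apply: sub_ideal_span.
by exists (y i) => //; apply: sub_ideal_span; exists i.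
Qed.

Lemma minimal_complM (a b : R) :
  minimal_compl a -> minimal_compl b -> minimal_compl (a * b).
Proof. by move=> ma mb P mP; rewrite prime_idealrM negb_or ma ?mb. Qed.

Lemma mem_tight_closure y i : y i \in TC y.
Proof.
apply/asboolP; exists 1; first by move=> P _; rewrite idealr1.
exists 0%N => e _; rewrite mul1r; apply: sub_ideal_span.
by exists (y i) => //; apply: sub_ideal_span; exists i.
Qed.

Definition power_at j (k : nat) y i := if i == j then y i ^+ k else y i.

(** A relation witnessing
    [c (y_j^k u)^q \in (y_j^((k+1)q), y_i^q)] reads
    [y_j^(kq) (c u^q - a y_j^q) \in (y_i^q : i <> j)], a relation on a system of
    parameters, so [c0] carries the bracket into [(y_i^q : i <> j)]. *)
Lemma tight_closure_colon c0 y j k (u : R) : is_ideal m -> minimal_compl c0 ->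
  colon_killer c0 -> parameters y ->
  y j ^+ k * u \in TC (power_at j k.+1 y) -> u \in TC y.
Proof.
move=> im mc0 cc py; case: (posnP k) => [->|k0].
  suff -> : power_at j 1 y = y by rewrite expr0 mul1r.
  by apply/funext => i; rewrite /power_at expr1; case: eqP.
move=> /asboolP[c mc [e0 H]]; apply/asboolP.
exists (c0 * c); first exact: minimal_complM.
exists e0 => e /H /bracket_power_span[a aE].
apply/bracket_power_span; apply/ideal_span_rangeP.
set q := (p ^ e)%N in aE *.
have q0 : (0 < q)%N by rewrite expn_gt0 prime_gt0 ?(pcharf_prime pR).
pose K := [set` ideal_span (range (fun i => y i ^+ q))].
have iK : @is_ideal R K by exact: set_ideal.
have Ky i : K (y i ^+ q) by apply: sub_ideal_span; exists i.
(* The relation has the parameters [y_j^(kq)] and [y_i^q], [i <> j]. *)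
pose n i := (if i == j then k * q else q)%N.
have py' : parameters (fun i => y i ^+ n i).
  by apply: parametersX => // i; rewrite /n; case: eqP; rewrite // muln_gt0 k0.
pose r i := if i == j then c * u ^+ q - a j * y j ^+ q else - a i.
suff : K (c0 * r j).
  rewrite /r eqxx mulrBr mulrA => Kr.
  by apply: (ideal_sub iK Kr); apply: ideal_M => //; apply: ideal_M.
apply: (cc _ r j K py' iK) => [|i /negPf ij]; last by rewrite /n ij.
move: aE; rewrite (bigD1 j) //= [in X in _ -> X](bigD1 j) //=.
rewrite /power_at /r /n !eqxx => aE.
rewrite (eq_bigr (fun i => - (a i * (if i == j then y i ^+ k.+1 else y i) ^+ q)));
  last by move=> i /negPf ->; rewrite mulNr.
rewrite sumrN; apply/eqP; rewrite subr_eq0; apply/eqP.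
rewrite exprMn -exprM in aE; rewrite -exprM mulSn exprD in aE.
move: aE; set s := \sum_(_ | _) _ => aE.
have -> : s = c * (y j ^+ (k * q) * u ^+ q) - a j * (y j ^+ q * y j ^+ (k * q)).
  by rewrite aE [X in X - _]addrC addrK.
ring.
Qed.

Lemma tight_closureM y (a u : R) : u \in TC y -> a * u \in TC y.
Proof. exact: ideal_mulr. Qed.

(** The ideal [B + (s^(j+1)) + s^j L], which interpolates between
    [B + (s^(j+1))] and [B + (s^j)]. *)
Definition layer B (s : R) (j : nat) L : set R :=
  [set r | exists t v, L t /\ B (r - v * s ^+ j.+1 - s ^+ j * t)].

Lemma layer_ideal B (s : R) (j : nat) L : is_ideal B -> is_ideal L -> is_ideal (layer B s j L).
Proof.
move=> iB iL; split.
- exists 0, 0; split; first exact: ideal_0.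
  by rewrite mul0r mulr0 !subr0; exact: ideal_0.
- move=> x z [t [v [Lt Bx]]] [t' [v' [Lt' Bz]]]; exists (t + t'), (v + v').
  split; first exact: ideal_D.
  have -> : x + z - (v + v') * s ^+ j.+1 - s ^+ j * (t + t') =
    (x - v * s ^+ j.+1 - s ^+ j * t) + (z - v' * s ^+ j.+1 - s ^+ j * t') by ring.
  exact: ideal_D.
- move=> a x [t [v [Lt Bx]]]; exists (a * t), (a * v).
  split; first exact: ideal_M.
  have -> : a * x - a * v * s ^+ j.+1 - s ^+ j * (a * t) =
    a * (x - v * s ^+ j.+1 - s ^+ j * t) by ring.
  exact: ideal_M.
Qed.

(** Multiplication by [s^j] keeps the inclusions strict because [(B : s^j)] and
    [s] lie in [A]. *)
Lemma layer_chain A B (s : R) (j l : nat) : is_ideal A -> is_ideal B -> A s ->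
  (forall u, B (s ^+ j * u) -> A u) -> chain l A setT ->
  chain l (adjoin B (s ^+ j.+1)) (adjoin B (s ^+ j)).
Proof.
move=> iA iB As BA c.
apply: (@chain_subl _ _ _ (layer B s j A)).
  by move=> x [v Bx]; exists 0, v; split; [exact: ideal_0|rewrite mulr0 subr0].
apply: (@chain_subr _ _ _ (layer B s j setT)).
  move=> x [t [v [_ Bx]]]; exists (v * s + t).
  by have -> : x - (v * s + t) * s ^+ j = x - v * s ^+ j.+1 - s ^+ j * t
    by rewrite exprS; ring.
have lS L L' : L `<=` L' -> layer B s j L `<=` layer B s j L'.
  by move=> LL' x [t [v [/LL' Lt Bx]]]; exists t, v.
suff H C : A `<=` C -> chain l C setT ->
  chain l (layer B s j C) (layer B s j setT) by exact: H.
elim: l C {c} => [|l IH] C AC /=; first exact: lS.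
move=> [I [J [iI iJ CI [IJ nJI] c]]]; exists (layer B s j I), (layer B s j J).
have AI := subset_trans AC CI.
split; [exact: layer_ideal|exact: layer_ideal|exact: lS| |].
  split; first exact: lS.
  move=> h; apply: nJI => u Ju.
  have [|t [v [It Bt]]] := h (s ^+ j * u).
    by exists u, 0; split=> //; rewrite mul0r subr0 subrr; exact: ideal_0.
  have /BA/AI : B (s ^+ j * (u - v * s - t)).
    have <- // : s ^+ j * u - v * s ^+ j.+1 - s ^+ j * t = s ^+ j * (u - v * s - t).
    by rewrite exprS; ring.
  move/(ideal_sub iI)/(_ It)/(ideal_sub iI); apply.
  by apply: ideal_M => //; exact: AI.
by apply: IH => //; exact: subset_trans IJ.
Qed.

(** The [k] layers of [layer_chain], for [j = k - 1, ..., 0], are end to end. *)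
Lemma power_chain A B (s : R) k l : is_ideal A -> is_ideal B -> A s ->
  (forall (j : nat) u, (j < k)%N -> B (s ^+ j * u) -> A u) ->
  chain l A setT -> chain (k * l) B setT.
Proof.
move=> iA iB As BA c.
have {BA}H (j : nat) : (j <= k)%N -> chain (j * l) (adjoin B (s ^+ j)) setT.
  elim: j => [|j IH] jk; first by [].
  rewrite mulSn; apply: chain_cat (IH (ltnW jk)).
  by apply: (layer_chain (A := A)) => // u; exact: BA.
apply: chain_subl (H k (leqnn k)); exact: sub_adjoin.
Qed.

Variables (c0 : R) (k : 'I_d -> nat) (x : 'I_d -> R).
Hypotheses (im : is_ideal m) (mc0 : minimal_compl c0) (killer : colon_killer c0).
Hypotheses (px : parameters x) (k_gt0 : forall i, (0 < k i)%N).

Lemma chain_power_at y j n l : parameters y -> (0 < n)%N ->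
  @chain R l [set` TC y] setT -> @chain R (n * l) [set` TC (power_at j n y)] setT.
Proof.
move=> py n0; apply: (power_chain (s := y j)); try exact: set_ideal.
- exact: mem_tight_closure.
- move=> i u it Tu; apply: (@tight_closure_colon c0 y j n.-1) => //.
  have in1 : (i <= n.-1)%N by rewrite -ltnS prednK.
  rewrite prednK // -(subnK in1) exprD -mulrA.
  exact: tight_closureM.
Qed.

(** The exponents are raised one parameter at a time. *)
Lemma chain_powers l : @chain R l [set` TC x] setT ->
  @chain R (\prod_i k i * l) [set` TC (fun i => x i ^+ k i)] setT.
Proof.
move=> c; pose y (s : seq 'I_d) i := if i \in s then x i ^+ k i else x i.
have {c}H (s : seq 'I_d) : uniq s ->
    @chain R (\prod_(i <- s) k i * l) [set` TC (y s)] setT.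
  elim: s => [_|j s IH] /=; first by rewrite big_nil mul1n.
  move=> /andP[js us]; rewrite big_cons -mulnA.
  suff -> : y (j :: s) = power_at j (k j) (y s).
    apply: chain_power_at => //; last exact: IH.
    have -> : y s = fun i => x i ^+ (if i \in s then k i else 1%N).
      by apply/funext => i; rewrite /y; case: ifP.
    by apply: parametersX => // i; case: ifP.
  apply/funext => i; rewrite /power_at /y inE.
  by case: eqP => // ->; rewrite (negPf js).
have := H (enum 'I_d) (enum_uniq _); rewrite big_enum.
by have -> : y (enum 'I_d) = fun i => x i ^+ k i
  by apply/funext => i; rewrite /y mem_enum.
Qed.

End TightClosureChains.

(** * Images of Cohen-Macaulay local rings *)

Section SurjectiveImage.
Variables (S R : comNzRingType) (f : {rmorphism S -> R}).
Hypothesis f_surj : forall r, exists s, f s = r.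
Let I : set S := [set s | f s = 0].

Let iI : is_ideal I.
Proof.
split; rewrite /I /=; first exact: rmorph0.
- by move=> x y fx fy; rewrite rmorphD fx fy addr0.
- by move=> a x fx; rewrite rmorphM fx mulr0.
Qed.

Lemma preimage_ideal J : is_ideal J -> is_ideal (f @^-1` J).
Proof.
move=> iJ; split; rewrite /preimage /=.
- by rewrite rmorph0; exact: (ideal_0 iJ).
- by move=> x y; rewrite rmorphD; exact: (ideal_D iJ).
- by move=> a x; rewrite rmorphM; exact: (ideal_M iJ).
Qed.

Lemma preimage_prime P : is_prime P -> is_prime (f @^-1` P).
Proof.
move=> pP; split; first exact/preimage_ideal/prime_ideal.
- by rewrite /preimage /= rmorph1; exact: prime_1.
- by move=> a b; rewrite /preimage /= rmorphM => /(prime_M pP).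
Qed.

Lemma ker_sub_preimage J : is_ideal J -> I `<=` f @^-1` J.
Proof. by move=> iJ x; rewrite /I /preimage /= => ->; exact: (ideal_0 iJ). Qed.

Lemma preimage_sub (A B : set R) : f @^-1` A `<=` f @^-1` B -> A `<=` B.
Proof. by move=> AB r; have [s <-] := f_surj r; exact: AB. Qed.

Lemma image_prime_mem P s : is_prime P -> I `<=` P -> (f @` P) (f s) -> P s.
Proof.
move=> pP IP [t Pt ft]; apply: (ideal_subr (prime_ideal pP) _ Pt).
by apply: IP; rewrite /I /= rmorphB ft subrr.
Qed.

Lemma preimage_image P : is_prime P -> I `<=` P -> f @^-1` (f @` P) = P.
Proof.
move=> pP IP; apply/seteqP; split=> s; first exact: image_prime_mem.
by move=> Ps; exists s.
Qed.

Lemma image_prime P : is_prime P -> I `<=` P -> is_prime (f @` P).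
Proof.
move=> pP IP; have iP := prime_ideal pP; split; first split.
- by exists 0; [exact: ideal_0|exact: rmorph0].
- move=> _ _ [x Px <-] [y Py <-]; exists (x + y); last exact: rmorphD.
  exact: (ideal_D iP).
- move=> a _ [x Px <-]; have [s <-] := f_surj a.
  by exists (s * x); [exact: (ideal_M iP)|exact: rmorphM].
- by rewrite -(rmorph1 f) => /(image_prime_mem pP IP); exact: prime_1.
- move=> a b; have [s <-] := f_surj a; have [t <-] := f_surj b.
  rewrite -rmorphM => /(image_prime_mem pP IP)/(prime_M pP)[Ps|Pt].
    by left; exists s.
  by right; exists t.
Qed.

Lemma coheight_preimage Q h : coheight_ge Q h -> coheight_ge (f @^-1` Q) h.
Proof.
elim: h Q => //= h IH Q [P [pP QP nPQ cP]]; exists (f @^-1` P); split.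
- exact: preimage_prime.
- exact: preimage_subset.
- by move=> /preimage_sub.
- exact: IH.
Qed.

Lemma minimal_over_image P : minimal_over I P -> minimal_over [set 0] (f @` P).
Proof.
move=> [pP IP minP]; have pfP := image_prime pP IP; split=> //.
  by move=> _ ->; exact: (ideal_0 (prime_ideal pfP)).
move=> Q pQ _ QP; apply: preimage_sub; rewrite preimage_image //.
apply: minP; first exact: preimage_prime.
  exact: (ker_sub_preimage (prime_ideal pQ)).
by rewrite -[X in _ `<=` X](preimage_image pP IP); exact: preimage_subset.
Qed.

Lemma minimal_over_preimage P : minimal_over [set 0] P -> minimal_over I (f @^-1` P).
Proof.
move=> [pP _ minP]; split; first exact: preimage_prime.
  exact: (ker_sub_preimage (prime_ideal pP)).
move=> Q pQ IQ QP; rewrite -[X in _ `<=` X](preimage_image pQ IQ).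
apply: preimage_subset; apply: minP; first exact: image_prime.
  by move=> _ ->; exact: (ideal_0 (prime_ideal (image_prime pQ IQ))).
by move=> _ [s Qs <-]; exact: QP.
Qed.

Variables (n : set S) (m : set R).
Hypotheses (mc : maximal_condition S) (locS : is_local n) (locR : is_local m).

Let In : I `<=` n.
Proof.
apply: (proper_sub_local locS iI); rewrite /I /= rmorph1 => /eqP.
by rewrite oner_eq0.
Qed.

Lemma local_preimage : f @^-1` m = n.
Proof.
apply/seteqP; split=> s.
  apply: (proper_sub_local locS); first exact/preimage_ideal/local_ideal.
  by rewrite /preimage /= rmorph1; exact: local_1.
move=> ns; apply: contrapT => /(local_unit locR)[v].
have [t <-] := f_surj v => fst; apply: (local_1 locS).
have nI := local_ideal locS.
apply: (ideal_sub nI (y := s * t)); last exact: ideal_Mr.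
by apply: In; rewrite /I /= rmorphB rmorph1 rmorphM fst subrr.
Qed.

Variables (N d : nat).
Hypotheses (depthS : depth_ge n [set 0] N)
  (dimS : forall (Q : set S) a b, is_prime Q -> height_ge Q a -> coheight_ge Q b ->
     (a + b <= N)%N).
Hypotheses (dimR : exists2 Q : set R, is_prime Q & coheight_ge Q d)
  (equiR : forall P : set R, minimal_over [set 0] P -> coheight_ge P d).
Hypothesis (sopR : exists x : 'I_d -> R, parameters m x).

(** The lifts to [S] of a system of parameters of [R], corrected by elements of
    the kernel, form a regular sequence to which [relation_annihilator] applies. *)
Lemma colon_killer_exists : exists2 c,
  forall P, minimal_over [set 0] P -> ~ P c & colon_killer m d c.
Proof.
have [g gK] := choice f_surj.
pose ext (y : 'I_d -> R) i := oapp y 0 (insub i).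
have extE (y : 'I_d -> R) (i : 'I_d) : ext y i = y i.
  by rewrite /ext insubT //= => id; congr y; apply: val_inj.
pose lift y i := g (ext y i).
have lift_n y i : parameters m y -> (i < d)%N -> n (lift y i).
  move=> [my _] id; rewrite -local_preimage /preimage /= gK.
  by rewrite -[i]/(nat_of_ord (Ordinal id)) extE.
have lift_prim y : parameters m y -> primary_mod n I (lift y) d.
  move=> [_ py] P pP IP Py; rewrite -local_preimage -(preimage_image pP IP).
  apply: preimage_subset; apply: py; first exact: image_prime.
  by move=> i; exists (lift y i); [exact: Py|rewrite /lift gK extE].
have [x px] := sopR.
have [J [iJ JI dJ minJ]] : exists J, [/\ is_ideal J, J `<=` I, depth_ge n J d &
    forall P, minimal_over I P -> minimal_over J P].
  apply: (equidimensional_cover mc locS (N := N) (y := lift x)) => //.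
  - by move=> i; exact: lift_n.
  - exact: lift_prim.
  - have [Q pQ cQ] := dimR; exists (f @^-1` Q); split.
    + exact: preimage_prime.
    + exact: (ker_sub_preimage (prime_ideal pQ)).
    + exact: coheight_preimage.
  move=> P mP; have [pP IP _] := mP; rewrite -(preimage_image pP IP).
  exact/coheight_preimage/equiR/minimal_over_image.
have [c nc cP] := relation_annihilator d mc iI iJ JI minJ.
exists (f c).
  by move=> P /minimal_over_preimage/nc.
move=> y r j K py iK ry Ky.
have [z Iz rz] := lift_parameters mc locS iI In iJ JI dJ
  (fun i => @lift_n y i py) (lift_prim y py).
have fz i : f (z i) = ext y i.
  by apply/eqP; rewrite -subr_eq0 -[ext y i]gK -rmorphB; apply/eqP/Iz.
have := cP z rz (lift r) (f @^-1` K) j (preimage_ideal iK)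
  (ker_sub_preimage iK).
rewrite /preimage /= rmorphM /lift gK extE; apply=> //.
  rewrite /I /= rmorph_sum -[RHS]ry; apply: eq_bigr => i _.
  by rewrite rmorphM gK fz !extE.
move=> i id ij; rewrite fz -[i]/(nat_of_ord (Ordinal id)) extE.
by apply: Ky; apply/eqP => ij'; apply: ij; rewrite -ij'.
Qed.

End SurjectiveImage.

(** * Dimension, depth and localization in terms of sets *)

Section DimensionDepth.
Variable R : comNzRingType.
Implicit Types (J K P Q : set R).

Lemma prime_of_set_proper P Q (pP : is_prime P) (pQ : is_prime Q) :
  P `<` Q -> [set` prime_of_set pP] `<` [set` prime_of_set pQ].
Proof. by rewrite !prime_of_setE. Qed.

Lemma local_ring_is_local (m : idealr R) :
  maximal_condition R -> local_ring m -> is_local [set` m].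
Proof.
move=> mc [_ m_max]; split; first exact: set_idealr.
  by rewrite /= idealr1.
move=> u mu; apply: contrapT => nu.
have [||J [iJ nJ1 Ju] maxJ] := mc (fun J => [/\ is_ideal J, ~ J 1 & J u]).
- exists (adjoin [set 0] u); split.
  + exact/adjoin_ideal/is_ideal0.
  + move=> [a /eqP]; rewrite subr_eq0 => /eqP e; apply: nu.
    by exists a; rewrite e mulrC.
  + exact/adjoin_self/is_ideal0.
- by move=> J [].
apply: mu; rewrite -(m_max (idealr_of_set iJ nJ1)) ?idealr_of_setE //.
move=> K; rewrite idealr_of_setE => JK; apply/seteqP; split=> //.
apply: maxJ => //; split; [exact: set_idealr|by rewrite /= idealr1|exact: JK].
Qed.

Lemma local_prime (m : set R) : is_local m -> is_prime m.
Proof.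
move=> loc; have im := local_ideal loc; split; [by []|exact: local_1|].
move=> a b mab; apply: contrapT => /not_orP[/(local_unit loc)[v av] nb].
by apply: nb; rewrite -[b]mul1r -av mulrAC; exact: ideal_Mr.
Qed.

Lemma coheight_chain d P (C : nat -> prime_idealr R) : P `<=` [set` C 0%N] ->
  (forall i, (i < d)%N -> [set` C i] `<` [set` C i.+1]) -> coheight_ge P d.
Proof.
elim: d P C => // d IH P C PC sC; have [C01 nC10] := sC 0%N isT.
exists [set` C 1%N]; split.
- exact: set_prime.
- exact: subset_trans C01.
- by move=> C1P; apply: nC10; exact: subset_trans PC.
by apply: (IH _ (fun i => C i.+1)) => // i id; exact: sC.
Qed.

Lemma height_chain h Q : is_prime Q -> height_ge Q h ->
  exists C : nat -> prime_idealr R, [set` C h] = Q /\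
    forall i, (i < h)%N -> [set` C i] `<` [set` C i.+1].
Proof.
elim: h Q => [|h IH] Q pQ; first by exists (fun=> prime_of_set pQ); rewrite prime_of_setE.
move=> [P [pP PQ nQP /(IH P pP)[C [CP sC]]]].
exists (fun i => if (i <= h)%N then C i else prime_of_set pQ); split.
  by rewrite ltnn prime_of_setE.
move=> i; rewrite ltnS => ih; have [il|hi|->] := ltngtP i h.
- exact: sC.
- by rewrite leqNgt hi in ih.
- by rewrite CP prime_of_setE.
Qed.

Lemma krull_dim_bound N Q a b : krull_dim R = N%:Z%:E -> is_prime Q ->
  height_ge Q a -> coheight_ge Q b -> (a + b <= N)%N.
Proof.
move=> /nat_sup_fin[_ dimN]; elim: b Q a => [|b IH] Q a pQ hQ.
  by move=> _; rewrite addn0; apply: dimN; have [C [_ sC]] := height_chain pQ hQ; exists C.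
move=> [P [pP QP nPQ cP]]; rewrite addnS -addSn; apply: (IH P) => //.
by exists Q.
Qed.

Lemma krull_dim_coheight d : krull_dim R = d%:Z%:E ->
  exists2 Q : set R, is_prime Q & coheight_ge Q d.
Proof.
move=> /nat_sup_fin[[C sC] _]; exists [set` C 0%N]; first exact: set_prime.
exact: (coheight_chain (C := C)).
Qed.

Lemma minimal_prime_over P (pP : is_prime P) :
  minimal_over [set 0] P -> minimal_prime (prime_of_set pP).
Proof.
move=> [_ _ minP] Q; rewrite prime_of_setE => QP.
apply/seteqP; split=> //; apply: minP => //; first exact: set_prime.
by move=> _ ->; exact: (ideal_0 (set_idealr Q)).
Qed.

Lemma minimal_over_prime (P : prime_idealr R) :
  minimal_prime P -> minimal_over [set 0] [set` P].
Proof.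
move=> minP; split; first exact: set_prime.
  by move=> _ ->; exact: (ideal_0 (set_idealr P)).
move=> Q pQ _ QP; have := minP (prime_of_set pQ).
by rewrite prime_of_setE => /(_ QP) ->.
Qed.

Lemma equidimensional_coheight d P : equidimensional R -> krull_dim R = d%:Z%:E ->
  minimal_over [set 0] P -> coheight_ge P d.
Proof.
move=> equi dimR mP; have [pP _ _] := mP.
have := equi _ (minimal_prime_over (pP := pP) mP); rewrite dimR => /nat_sup_fin[[C sC] _].
set p := prime_of_set pP in C sC.
pose pi (x : R) : {ideal_quot p} := \pi_{ideal_quot p} x.
have pi_surj (y : {ideal_quot p}) : exists x, pi x = y by exists (repr y); exact: reprK.
have pC i : is_prime (pi @^-1` [set` C i]).
  have [iC C1 CM] := set_prime (C i); split; first split.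
  - by rewrite /preimage /pi /= raddf0; exact: (ideal_0 iC).
  - by move=> x y; rewrite /preimage /pi /= raddfD; exact: (ideal_D iC).
  - by move=> a x; rewrite /preimage /pi /= rmorphM; exact: (ideal_M iC).
  - by rewrite /preimage /pi /= rmorph1.
  - by move=> a b; rewrite /preimage /pi /= rmorphM; exact: CM.
apply: (coheight_chain (C := fun i => prime_of_set (pC i))).
  move=> x Px; rewrite prime_of_setE /preimage /=.
  suff -> : pi x = 0 by exact: rpred0.
  rewrite /pi -(raddf0 (\pi_{ideal_quot p})); apply/eqP.
  by rewrite -Quotient.idealrBE subr0; apply/asboolP.
move=> i id; apply: prime_of_set_proper; have [s ns] := sC i id.
split; first exact: preimage_subset.
move=> h; apply: ns => y; have [x <-] := pi_surj y; exact: h.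
Qed.

Lemma regular_sequence_dep (m : idealr R) (s : seq R) :
  {subset s <= m} -> regular_sequence s -> depth_ge [set` m] [set 0] (size s).
Proof.
move=> sm [rs _].
pose E i := [set` ideal_span [set` take i s]] : set R.
have iE i : is_ideal (E i) by exact: set_ideal.
have E0 : E 0%N = [set 0].
  apply/seteqP; split=> x.
    rewrite /E take0 => /(@ideal_spanP R) x0; apply: (x0 [set 0] (is_ideal0 R)).
    by move=> y.
  by move=> ->; exact: (ideal_0 (iE 0%N)).
have ES i : (i < size s)%N -> E i.+1 = adjoin (E i) s`_i.
  move=> is_; have := iE i.+1; rewrite /E (take_nth 0) // => iE1.
  apply/seteqP; split=> x.
    move=> /(@ideal_spanP R) xs; apply: (xs _ (adjoin_ideal s`_i (iE i))).
    move=> y; rewrite /= mem_rcons inE => /predU1P[->|ys].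
      exact: adjoin_self.
    by apply: sub_adjoin => //; apply: sub_ideal_span.
  apply: (adjoin_sub iE1).
    move=> y /(@ideal_spanP R) ys; apply: (ys _ iE1) => z zs.
    by apply: sub_ideal_span; rewrite /= mem_rcons inE zs orbT.
  by apply: sub_ideal_span; rewrite /= mem_rcons inE eqxx.
rewrite -E0; have : (0 + size s = size s)%N by [].
move: {1 3}(size s) {1 2}0%N => k; elim: k => //= k IH i ik.
have is_ : (i < size s)%N by rewrite -ik addnS ltnS leq_addr.
exists s`_i; split.
- exact/sm/mem_nth.
- move=> r Er; have := rs i is_ (\pi_(R^o /% ideal_span [set` take i s]) (r : R^o)).
  have -> : s`_i *: \pi_(R^o /% ideal_span [set` take i s]) (r : R^o) = 0.
    rewrite -[LHS]/(lmod_quot_scale _ _) lmod_quot_scale_pi.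
    exact: quot_pi_in.
  move=> /(_ erefl) => e; rewrite /E /= -[r]subr0; apply: quot_pi_eq.
  by rewrite raddf0.
by rewrite -ES //; apply: IH; rewrite addSn -addnS.
Qed.

(** The number of generators of the maximal ideal bounds the depth, by
    [depth_ge_assoc]; this excludes the value [+oo] for depth and dimension. *)
Lemma cohen_macaulay_depth (m : idealr R) : cohen_macaulay_local m ->
  exists N : nat, depth_ge [set` m] [set 0] N /\ krull_dim R = N%:Z%:E.
Proof.
move=> [noeth locm]; have mc := noetherian_maximal_condition noeth.
have loc := local_ring_is_local mc locm.
rewrite /depth /krull_dim; set A := [set n | _]; set B := [set n | _] => eAB.
have AP N : A N -> depth_ge [set` m] [set 0] N.
  by move=> [s [<- sm rs]]; exact: regular_sequence_dep.
have B0 : B !=set0.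
  by exists 0%N; exists (fun=> prime_of_set (local_prime loc)).
case: (nat_sup_dichotomy B0) => [[N [_ _ eN]]|[_ einf]].
  exists N; split=> //; apply: AP.
  by move: eAB; rewrite eN => /nat_sup_fin[].
have A0 : A !=set0.
  by apply/set0P/eqP => A0; move: eAB; rewrite einf A0 /nat_sup image_set0 supremum0.
case: (nat_sup_dichotomy A0) => [[N [_ _ eN]]|[unb _]].
  by move: eAB; rewrite einf eN.
have [g] := noeth (ideal_of_set (set_idealr m)).
have -> : [set` ideal_of_set (set_idealr m)] = [set` m].
  by apply/seteqP; split=> x /(ideal_of_setE (set_idealr m)).
move=> mg; have [k Ak gk] := unb (size g).
have [||P aP _] := @assoc_prime_above R mc [set 0] 1 set0 (is_ideal0 R).
- by move=> /eqP; rewrite oner_eq0.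
- by [].
suff : (k <= size g)%N by rewrite leqNgt gk.
apply: (depth_ge_assoc mc loc (is_ideal0 R) (AP k Ak) aP (y := fun i => g`_i)).
  by move=> i ig; rewrite mg; apply: sub_ideal_span; exact: mem_nth.
move=> Q pQ _ Qg; rewrite mg => x /(@ideal_spanP R) xg; apply: (xg Q (prime_ideal pQ)).
by move=> y /(nthP 0)[i ig <-]; exact: Qg.
Qed.

End DimensionDepth.

(** ** The map from a localization *)

Section LocalizationMap.
Variables (S R : comNzRingType) (f : {rmorphism S -> R}) (P : prime_idealr S).
Hypothesis f_unit : forall s, s \notin P -> exists v, f s * v = 1.

Local Notation num x := (sval x).1.
Local Notation den x := (sval x).2.
Local Notation L := (localization P).
Local Notation pi := (\pi_L).

Definition image_inverse (u : R) : R := xget 0 [set v | u * v = 1].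

Lemma image_inverseK s : s \notin P -> f s * image_inverse (f s) = 1.
Proof.
move=> /f_unit[v sv]; rewrite /image_inverse.
by case: xgetP => [w _ //|/(_ v)]; case.
Qed.

Lemma image_cancel s (a b : R) : s \notin P -> f s * a = f s * b -> a = b.
Proof.
move=> /image_inverseK sv e; rewrite -[a]mul1r -[b]mul1r -sv.
by rewrite ![f s * _]mulrC -!mulrA e.
Qed.

Definition loc_map (y : L) : R :=
  f (num (repr y)) * image_inverse (f (den (repr y))).

Lemma loc_map_pi (x : loc_frac P) : f (den x) * loc_map (pi x) = f (num x).
Proof.
rewrite /loc_map; have [u uP] := loc_repr x.
set y := repr (pi x) => /(congr1 f); rewrite rmorphM rmorphB !rmorphM rmorph0 => e.
apply: (image_cancel uP); apply: (image_cancel (denP y)).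
have -> : f (den y) * (f u * (f (den x) * (f (num y) * image_inverse (f (den y))))) =
    f u * f (den x) * f (num y) * (f (den y) * image_inverse (f (den y))) by ring.
rewrite image_inverseK ?denP // mulr1; apply/eqP; rewrite -subr_eq0 -e.
by apply/eqP; ring.
Qed.

Lemma loc_map_uniq (x : loc_frac P) r : f (den x) * r = f (num x) -> loc_map (pi x) = r.
Proof. by move=> e; apply: (image_cancel (denP x)); rewrite loc_map_pi. Qed.

Fact loc_map_zmod : zmod_morphism loc_map.
Proof.
elim/quotW=> x; elim/quotW=> y.
have -> : pi x - pi y = pi (fadd x (fopp y)).
  by rewrite -[LHS]/(loc_add _ (loc_opp _)) pi_fopp pi_fadd.
apply: loc_map_uniq; rewrite /= rmorphD !rmorphM rmorphN -!loc_map_pi.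
ring.
Qed.

Fact loc_map_monoid : monoid_morphism loc_map.
Proof.
split.
  by apply: (@loc_map_uniq (mkfrac 1 (prime_notin1 P))); rewrite /= mulr1.
elim/quotW=> x; elim/quotW=> y.
have -> : pi x * pi y = pi (fmul x y) by rewrite -[LHS]/(loc_mul _ _) pi_fmul.
apply: loc_map_uniq; rewrite /= !rmorphM -!loc_map_pi.
ring.
Qed.

HB.instance Definition _ := GRing.isZmodMorphism.Build L R loc_map loc_map_zmod.
HB.instance Definition _ := GRing.isMonoidMorphism.Build L R loc_map loc_map_monoid.

Definition loc_rmorphism : {rmorphism L -> R} := loc_map.

Lemma loc_map_frac s : loc_map (pi (mkfrac s (prime_notin1 P))) = f s.
Proof. by apply: loc_map_uniq; rewrite /= rmorph1 mul1r. Qed.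

End LocalizationMap.

(** * The theorem *)

Lemma sop_parameters (R : comNzRingType) (m : idealr R) d (x : 'I_d -> R) :
  system_of_parameters m x -> parameters [set` m] x.
Proof.
move=> [_ mx _ rad]; split=> // Q pQ Qx r; rewrite -rad => -[k /(@ideal_spanP R) xr].
apply: (prime_X (n := k) pQ); apply: (xr Q (prime_ideal pQ)).
by move=> _ [i _ <-].
Qed.

(** Localizing the Cohen-Macaulay ring at the preimage of [m] makes it local; the
    map to [R] extends because elements outside [m] are units. *)
Lemma colon_killer_of_image (R : comNzRingType) (m : idealr R) d (x : 'I_d -> R) :
  noetherian R -> local_ring m -> equidimensional R ->
  (exists2 S : comNzRingType, cohen_macaulay S & homomorphic_image S R) ->
  system_of_parameters m x ->
  exists2 c, minimal_compl c & colon_killer [set` m] d c.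
Proof.
move=> noethR locm equi [S [_ cmS] [f f_surj]] sop.
have mcR := noetherian_maximal_condition noethR.
have locR := local_ring_is_local mcR locm.
have dimR : krull_dim R = d%:Z%:E by case: sop.
have pP : is_prime (f @^-1` [set` m]) by exact/preimage_prime/local_prime.
pose P := prime_of_set pP.
have PE s : s \in P -> m (f s) by move=> /asboolP.
have f_unit s : s \notin P -> exists v, f s * v = 1.
  by move=> sP; apply: (local_unit locR) => ms; apply: (negP sP); apply/asboolP.
have maxP : maximal P.
  move=> J; rewrite prime_of_setE => PJ; apply/seteqP; split=> // s Js.
  apply: contrapT => ms; have [v] : exists v, f s * v = 1.
    exact: (local_unit locR).
  have [t <-] := f_surj v => fst.
  have : 1 \in J.
    rewrite -(subrK (s * t) 1); apply: rpredD; last by rewrite mulrC idealMr.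
    apply: PJ; rewrite /preimage /= rmorphB rmorph1 rmorphM fst subrr.
    exact: rpred0.
  by rewrite idealr1.
have [n cmn] := cmS P maxP.
have [N [depN dimN]] := cohen_macaulay_depth cmn.
have [noethL locn _] := cmn.
have mcL := noetherian_maximal_condition noethL.
have locL := local_ring_is_local mcL locn.
have [|||||c mc kc] := @colon_killer_exists _ _ (loc_rmorphism f_unit) _ _ [set` m]
    mcL locL locR N d depN.
- move=> r; have [s <-] := f_surj r.
  by exists (\pi_(localization P)%qT (mkfrac s (prime_notin1 P))); exact: loc_map_frac.
- move=> Q a b; exact: krull_dim_bound.
- exact: krull_dim_coheight.
- by move=> Q; exact: equidimensional_coheight.
- by exists x; exact: sop_parameters.
exists c => // Q mQ; apply/negP; exact: mc (minimal_over_prime mQ).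
Qed.

Theorem theorem1p1 (R : comNzRingType) (m : idealr R) (p : nat)
  (pR : p \in [pchar R])
  (noethR : noetherian R) (locR : local_ring m) (equiR : equidimensional R)
  (cmR : exists2 S : comNzRingType, cohen_macaulay S & homomorphic_image S R)
  (d : nat) (x : 'I_d -> R) (sopx : system_of_parameters m x)
  (k : 'I_d -> nat) (k_ge1 : forall i, (1 <= k i)%N) :
  ((\prod_(i < d) k i)%N%:Z%:E
     * length (R^o /% tight_closure pR (ideal_span (range x)))
   <= length (R^o /% tight_closure pR
                (ideal_span (range (fun i => (x i ^+ k i)%R)))))%E.
Proof.
have [c mc kc] := colon_killer_of_image noethR locR equiR cmR sopx.
apply: le_length => [|l]; first by rewrite prodn_gt0.
exact: (chain_powers (set_idealr m) mc kc (sop_parameters sopx)).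
Qed.
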